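(* Let $n,k\ge 1$ be integers, let $e$ be an integer with $1\le e\leq e_{n,k+1}:=|E(\mathcal{T}_{n,k+1})|$, let $H_e=H_e^{n,k+1}$ be the subgraph of $\mathcal{T}_{n,k+1}$ defined in the context, and let $G$ be any graph on $n$ vertices with $e$ edges. Then \[\beta_{k}(X(G))\leq \beta_k(X(H_e)).\]
   Context: Graphs are finite and simple. For a graph $G$, $X(G)$ denotes the flag complex of $G$: the simplicial complex on $V(G)$ whose $m$-simplices are the $(m+1)$-cliques of $G$. $\beta_k(K)$ denotes the dimension of the reduced simplicial homology $\tilde H_k(K;\mathbf{k})$ with coefficients in a fixed but arbitrary field $\mathbf{k}$. The Turán graph $\mathcal{T}_{n,k+1}$ is the complete $(k+1)$-partite graph on $n$ vertices with part sizes as equal as possible. Definition of $H_e$: label the vertices of $\mathcal{T}_{n,k+1}$ as $v_1,\dots,v_n$ so that $v_i$ and $v_{i+k+1}$ always lie in the same partition class (so $v_i,v_j$ are adjacent iff $i\not\equiv j \bmod (k+1)$). Write each edge as $e_{i,j}=\{v_i,v_j\}$ with $i<j$ and order the edges co-lexicographically: $e_{i,j}<e_{i',j'}$ if $j<j'$, or if $j=j'$ and $i<i'$. For $1\le e\le e_{n,k+1}$, $H_e=H_e^{n,k+1}$ is the subgraph of $\mathcal{T}_{n,k+1}$ on all $n$ vertices whose edges are the first $e$ edges in this order. *)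

(* Defs.v *)
From HB Require Import structures.
From mathcomp Require Import all_boot all_order all_algebra.

Set Implicit Arguments.
Unset Strict Implicit.
Unset Printing Implicit Defensive.

Import GRing.Theory.
Local Open Scope ring_scope.

(** * Reduced simplicial homology over a field

    A complex on the vertex type [T] is a set of faces [K : {set {set T}}]; the
    empty face, when present, is the simplex of dimension -1, so that homology
    is reduced. *)

(* Indexed by the number of vertices: an element has dimension [m - 1]. *)
Definition simplices (T : finType) (K : {set {set T}}) (m : nat) :
  {set {set T}} := [set A in K | #|A| == m].

(* Simplices are oriented by the order in which [T] is enumerated, so this is
   the position of [v] among the vertices of [A]. *)
Definition vpos (T : finType) (A : {set T}) (v : T) : nat :=
  #|[set w in A | (enum_rank w < enum_rank v)%N]|.

(* The coefficient of [B] in the alternating sum of the facets of [A]. *)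
Definition incidence (F : fieldType) (T : finType) (A B : {set T}) : F :=
  \sum_(v in A | A :\ v == B) (-1) ^+ vpos A v.

(* The boundary map from dimension [m] to dimension [m - 1]; as usual in
   MathComp, chains are row vectors and maps act by right multiplication. *)
Definition boundary (F : fieldType) (T : finType) (K : {set {set T}}) (m : nat) :
  'M[F]_(#|simplices K m.+1|, #|simplices K m|) :=
  \matrix_(i, j) incidence F (enum_val i) (enum_val j).

(* Cycles modulo boundaries: [cokermx (boundary F K k.+1)] is a linear map on
   [k]-chains whose kernel is the space of [k]-boundaries, and the row space
   below is the image of the space of [k]-cycles under it. *)
Definition homology (F : fieldType) (T : finType) (K : {set {set T}}) (k : nat) :
  'M[F]_#|simplices K k.+1| :=
  kermx (boundary F K k) *m cokermx (boundary F K k.+1).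

Definition betti (F : fieldType) (T : finType) (K : {set {set T}}) (k : nat) :
  nat := \rank (homology F K k).

(** * Graphs, given by a symmetric and irreflexive adjacency relation *)

Definition edges (T : finType) (adj : rel T) : {set {set T}} :=
  [set [set p.1; p.2] | p : T * T & adj p.1 p.2].

Definition clique (T : finType) (adj : rel T) (A : {set T}) : bool :=
  [forall x in A, forall y in A, (x != y) ==> adj x y].

Definition flag_complex (T : finType) (adj : rel T) : {set {set T}} :=
  [set A | clique adj A].

(* The Turan graph with [r] classes; [i : 'I_n] stands for the vertex v_(i+1). *)
Definition turan (n r : nat) : rel 'I_n :=
  fun i j => (i != j %[mod r])%N.
Arguments turan n r i j : clear implicits.

(* Reflexive co-lexicographic order on edges written as increasing pairs. *)
Definition colex (n : nat) : rel ('I_n * 'I_n) :=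
  fun p q => ((p.2 < q.2) || ((p.2 == q.2) && (p.1 <= q.1)))%N.

Definition turan_edge_list (n r : nat) : seq ('I_n * 'I_n) :=
  sort (@colex n)
    [seq p : 'I_n * 'I_n <- enum {: 'I_n * 'I_n} |
       (p.1 < p.2)%N && turan n r p.1 p.2].

Definition H_graph (n r e : nat) : rel 'I_n :=
  fun i j => ((i, j) \in take e (turan_edge_list n r))
          || ((j, i) \in take e (turan_edge_list n r)).
Arguments H_graph n r e i j : clear implicits.

(* Main.v *)
From HB Require Import structures.
Require Import Defs.
From mathcomp Require Import all_boot all_order all_algebra zify.

Set Implicit Arguments.
Unset Strict Implicit.
Unset Printing Implicit Defensive.
Import GRing.Theory.

(** Put c = k + 1.  For the Turan graph with c classes on m vertices let
    [turan_edges c m] be its number of edges, [turan_betti c m] the product of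
    (size - 1) over its classes, which is its Betti number in degree c - 1, and
    [turan_deg c m] the number of neighbours of the vertex that comes next.
    Every e in the range of the theorem is [turan_edges c m + t] with
    0 < t <= [turan_deg c m].  Then H_e consists of the Turan graph on the first
    m vertices, of one vertex joined to t of them, and of isolated vertices.
    The t neighbours span a balanced complete (c-1)-partite graph, and an
    earlier vertex of the class of the new vertex sees all of them; so cycles
    of the link of the new vertex extend to cycles of H_e.  (If there is no
    earlier vertex in this class, then t < c and the link has no such cycles.)
    Hence the Betti number of H_e is at least
    [turan_betti c m + turan_betti (c - 1) t] ([H_graph_lower]).  What remains is that no graph with at most
    [turan_edges c m + t] edges exceeds this number ([ibetti_edges]).

    The tool is b_k(G) <= b_k(G - u) + b_(k-1)(link of u) ([ibetti_del]), used
    in two ways.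

    First, deleting the nonneighbours of a vertex v one after the other leaves
    a cone with apex v, which has no homology.  So b_k(G) is at most the sum of
    the Betti numbers of the links met on the way, while the sizes of these
    links add up to the number of edges of G with an end outside N[v]
    ([remove_nonneighbours]).  For v of maximal degree this gives the bound
    [turan_betti c n] for n vertices, by induction on c ([ibetti_vertices]).

    Second, delete a vertex u of minimal degree d, bound its link by
    [turan_betti (c - 1) d], and apply induction to G - u.  Since [turan_betti]
    is convex, this is enough when d <= t or d <= [turan_deg c (m - 1)].  If
    both fail, then counting edges shows that G has exactly m + 1 vertices and
    that all degrees are at least d = [turan_deg c m]
    ([edge_bound_or_regular]).

    In this nearly regular case the links are bounded through their edges as
    well, by induction on c.  Let v be a vertex whose link has the most edges,
    counted up to the Turan number of its size ([link_edges]).  If this maximum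
    is small, then the link of u is already small enough.  Otherwise the
    deletion of the nonneighbours of v reduces the claim to arithmetic
    ([sum_truncated_le]): the worst case looks like a complete c-partite graph
    with one class that may be too small and the others balanced, plus one
    incomplete vertex.  Moving a vertex of such a graph from a larger class to
    the small one gains as many spheres per gained edge as the links allow, so
    that the comparison with the Turan graph closes ([multipartite_loss]). *)

(** * Arithmetic of Turan graphs *)

(** The classes of a balanced partition of n points into c classes have at
    least [n %/ c] elements, and a new vertex joins a smallest class: it is
    adjacent to the [n - n %/ c] others. *)
Definition turan_deg (c n : nat) : nat := n - n %/ c.
Definition turan_edges (c n : nat) : nat := \sum_(i < n) turan_deg c i.

(** The recursion splits off a smallest class; the remaining classes are again
    balanced.  Truncated subtraction gives the value 0 as soon as some class is
    empty, and the graph without classes carries the class of degree -1. *)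
Fixpoint turan_betti (c n : nat) : nat :=
  if c is c'.+1 then (n %/ c - 1) * turan_betti c' (turan_deg c n) else 1.

Arguments turan_betti : simpl never.

Lemma turan_bettiS c n :
  turan_betti c.+1 n = (n %/ c.+1 - 1) * turan_betti c (turan_deg c.+1 n).
Proof. by []. Qed.

Lemma turan_degS c n :
  turan_deg c.+1 n.+1 =
    if c.+1 %| n.+1 then turan_deg c.+1 n else (turan_deg c.+1 n).+1.
Proof.
rewrite /turan_deg divnS //; have := leq_div n c.+1.
by case: ifP => _; lia.
Qed.

Lemma turan_deg0 c : turan_deg c 0 = 0. Proof. by rewrite /turan_deg div0n. Qed.

Lemma turan_deg_le c n : turan_deg c n <= n. Proof. exact: leq_subr. Qed.

Lemma leq_turan_deg c m n : m <= n -> turan_deg c.+1 m <= turan_deg c.+1 n.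
Proof.
move=> /subnKC <-; elim: (n - m) => [|d IH]; first by rewrite addn0.
by rewrite addnS turan_degS; case: ifP => _ //; rewrite (leq_trans IH).
Qed.

Lemma turan_deg_gt0 c n : 0 < n -> 0 < turan_deg c.+2 n.
Proof. by move=> n0; rewrite subn_gt0 ltn_Pdiv. Qed.

Lemma turan_edges0 c : turan_edges c 0 = 0.
Proof. by rewrite /turan_edges big_ord0. Qed.

Lemma turan_edgesS c n : turan_edges c n.+1 = turan_edges c n + turan_deg c n.
Proof. by rewrite /turan_edges big_ord_recr. Qed.

Lemma leq_turan_edges c m n : m <= n -> turan_edges c m <= turan_edges c n.
Proof.
move=> /subnKC <-; elim: (n - m) => [|d IH]; first by rewrite addn0.
by rewrite addnS turan_edgesS (leq_trans IH) // leq_addr.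
Qed.

(** If the classes do not all become equal when a vertex is added, then a
    smallest class is still a smallest one after another such class is removed:
    write n = q (c + 2) + r with r <= c. *)
Lemma div_turan_deg c n : ~~ (c.+2 %| n.+1) -> turan_deg c.+2 n %/ c.+1 = n %/ c.+2.
Proof.
move=> ndiv; rewrite /turan_deg.
have := divn_eq n c.+2; have := ltn_pmod n (isT : 0 < c.+2).
move: (n %/ c.+2) (n %% c.+2) => q r ltr eqn.
have rc : r < c.+1.
  rewrite ltn_neqAle -ltnS ltr andbT; apply: contra ndiv => /eqP re.
  by rewrite eqn re -addnS -mulSnr dvdn_mull.
have -> : n - q = q * c.+1 + r by rewrite eqn; nia.
by rewrite divnMDl // divn_small // addn0.
Qed.

(** The new vertex contributes the spheres of its link. *)
Lemma turan_betti_step c n :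
  turan_betti c.+2 n.+1 = turan_betti c.+2 n + turan_betti c.+1 (turan_deg c.+2 n).
Proof.
elim: c n => [|c IH] n; rewrite turan_bettiS [in RHS]turan_bettiS.
  rewrite !(turan_bettiS 0) /turan_deg !divn1 !divn2 -[n.+1./2]/(uphalf n) !muln1.
  by rewrite uphalf_half; have := odd_double_half n; case: (odd n); nia.
rewrite turan_degS; case: ifPn => dv; rewrite divnS //.
  rewrite dv /=; case eqq: (n %/ c.+3) => [|q].
    have n3 : n = c.+2.
      have := dvdn_leq (isT : 0 < n.+1) dv.
      by have := divn_eq n c.+3; have := ltn_pmod n (isT : 0 < c.+3); rewrite eqq; lia.
    by rewrite n3 /turan_deg divn_small // subn0 turan_bettiS divnn.
  by rewrite -/(turan_betti c.+2 _); lia.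
rewrite (negbTE dv) add0n IH mulnDr; congr (_ + _).
by rewrite [in RHS]turan_bettiS div_turan_deg.
Qed.

Lemma turan_betti0 c : turan_betti c.+1 0 = 0.
Proof. by rewrite turan_bettiS div0n. Qed.

Lemma turan_betti_small c n : n <= c.+1 -> turan_betti c.+1 n = 0.
Proof.
move=> nc; rewrite turan_bettiS; case: ltngtP nc => // [nc _|-> _].
  by rewrite divn_small.
by rewrite divnn.
Qed.

Lemma turan_betti1 n : turan_betti 1 n = n.-1.
Proof. by rewrite turan_bettiS divn1 muln1 subn1. Qed.

Lemma leq_turan_betti c m n : m <= n -> turan_betti c m <= turan_betti c n.
Proof.
case: c => [//|[|c]]; first by rewrite !turan_betti1; lia.
move=> /subnKC <-; elim: (n - m) => [|d IH]; first by rewrite addn0.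
by rewrite addnS turan_betti_step (leq_trans IH) // leq_addr.
Qed.

(** By [turan_betti_step] the increments are Betti numbers of smaller Turan
    graphs, which grow; this is convexity. *)
Lemma turan_betti_incr c m n : m <= n ->
  turan_betti c.+1 m.+1 + turan_betti c.+1 n <=
  turan_betti c.+1 m + turan_betti c.+1 n.+1.
Proof.
case: c => [|c] mn; first by rewrite !turan_betti1; lia.
rewrite !turan_betti_step; have := leq_turan_betti c.+1 (leq_turan_deg c.+1 mn); lia.
Qed.

Lemma turan_betti_convex c m n d : m <= n ->
  turan_betti c.+1 (m + d) + turan_betti c.+1 n <=
  turan_betti c.+1 m + turan_betti c.+1 (n + d).
Proof.
move=> mn; elim: d => [|d IH]; first by rewrite !addn0.
have := @turan_betti_incr c (m + d) (n + d); rewrite leq_add2r !addnS => /(_ mn); lia.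
Qed.

Lemma turan_betti_superadd c m n :
  turan_betti c.+1 m + turan_betti c.+1 n <= turan_betti c.+1 (m + n).
Proof.
have := @turan_betti_convex c 0 n m isT.
by rewrite turan_betti0 add0n addnC [n + m]addnC; lia.
Qed.

(** Convexity for truncated decrements; it holds beyond the range [i <= m]
    because the function vanishes at 0. *)
Lemma turan_betti_shift c m n i : m <= n ->
  turan_betti c.+1 m + turan_betti c.+1 (n - i) <=
  turan_betti c.+1 n + turan_betti c.+1 (m - i).
Proof.
move=> mn; case: (leqP i m) => im.
  have := @turan_betti_convex c (m - i) (n - i) i.
  by rewrite !subnK ?(leq_trans im mn) // leq_sub2r // => /(_ isT); lia.
have := turan_betti_superadd c m (n - m); rewrite subnKC //.
have := @leq_turan_betti c.+1 (n - i) (n - m); lia.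
Qed.

(** A class that has just grown to size x / (c + 1) + 1 is a largest class, and
    the others are balanced. *)
Lemma turan_betti_succ c x : 0 < x %/ c.+1 ->
  turan_betti c.+1 x.+1 = x %/ c.+1 * turan_betti c (turan_deg c.+1 x).
Proof.
case: c => [|c] x0; first by rewrite turan_betti1 divn1 muln1.
by rewrite turan_betti_step turan_bettiS; move: x0; nia.
Qed.

Lemma turan_edges_split c n :
  turan_edges c.+2 n =
  turan_edges c.+1 (turan_deg c.+2 n) + n %/ c.+2 * turan_deg c.+2 n.
Proof.
elim: n => [|n IH]; first by rewrite turan_deg0 !turan_edges0 muln0.
rewrite turan_edgesS IH turan_degS divnS //; case: ifPn => dv /=.
  by nia.
rewrite add0n turan_edgesS [turan_deg c.+1 (turan_deg _ _)]/turan_deg div_turan_deg //.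
have : n %/ c.+2 <= turan_deg c.+2 n by rewrite -(div_turan_deg dv) leq_div.
by nia.
Qed.

(** Handshake: in the Turan graph on n vertices the vertices of the smaller
    classes have degree [turan_deg], and those of the larger classes, of which
    there are [n %% c.+1] with [(n %/ c.+1).+1] elements, have one neighbour
    less. *)
Lemma turan_edges_exact c n :
  (turan_edges c.+1 n).*2 + n %% c.+1 * (n %/ c.+1).+1 = n * turan_deg c.+1 n.
Proof.
elim: n => [|n IH]; first by rewrite turan_edges0 mod0n.
rewrite turan_edgesS turan_degS divnS // doubleD; move: IH; rewrite /turan_deg.
case: ifPn => dv /=.
  have /eqP -> := dv; rewrite mul0n addn0 => IH.
  have rc : n %% c.+1 = c.
    have := ltn_pmod n (isT : 0 < c.+1).
    have /eqP := dv; rewrite -addn1 -modnDml; move: (n %% c.+1) => r.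
    rewrite ltnS leq_eqVlt => /[swap] /orP[/eqP-> _|rc] //.
    by rewrite modn_small; lia.
  move: IH; have := divn_eq n c.+1; rewrite rc.
  by move: (n %/ c.+1) (turan_edges _ _) => q E; nia.
have -> : n.+1 %% c.+1 = (n %% c.+1).+1.
  rewrite -addn1 -modnDml addn1 modn_small // ltn_neqAle ltn_pmod // andbT.
  apply: contra dv => /eqP rc.
  by rewrite (divn_eq n c.+1) -addnS rc dvdn_addl // dvdn_mull.
have := divn_eq n c.+1.
by move: (n %/ c.+1) (n %% c.+1) (turan_edges _ _) => q r E; nia.
Qed.

(** The complete multipartite graph with a class of a + 1 vertices and the
    others balanced on x vertices, against the one with a vertex moved from the
    first class to the others: the number of spheres drops by the last term,
    whose first factor is also the change of the number of edges. *)
Lemma turan_betti_shift_eq c a x : 0 < a <= x %/ c.+1 ->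
  a * turan_betti c.+1 x =
  (a - 1) * turan_betti c.+1 x.+1 + (x %/ c.+1 - a) * turan_betti c (turan_deg c.+1 x).
Proof.
case/andP=> a0 ax; rewrite turan_betti_succ ?(leq_trans a0) // turan_bettiS.
move: (x %/ c.+1) (turan_betti c _) ax => k X ax; rewrite !mulnA -mulnDl.
by congr (_ * _); nia.
Qed.

Lemma turan_betti_shift_le c a x : x %/ c.+1 <= a ->
  a * turan_betti c.+1 x <= (a - 1) * turan_betti c.+1 x.+1.
Proof.
case: (posnP (x %/ c.+1)) => [x0 _|x0 xa]; first by rewrite turan_bettiS x0 muln0.
rewrite turan_betti_succ // turan_bettiS.
move: (x %/ c.+1) (turan_betti c _) x0 xa => k X k0 ka; rewrite !mulnA leq_mul2r.
by apply/orP; right; nia.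
Qed.

(** Among the complete multipartite graphs the balanced one has the most
    spheres.  The left-hand side, as a function of a with a + b fixed, increases
    up to a = (a + b) / (c + 1), where it equals the right-hand side by
    definition, and decreases afterwards. *)
Lemma turan_betti_join c a b : (a - 1) * turan_betti c b <= turan_betti c.+1 (a + b).
Proof.
case: c => [|c]; first by rewrite turan_betti1 muln1; lia.
set n := a + b; set q := n %/ c.+2.
have qn : q <= n := leq_div _ _.
have n_eq : n = q * c.+2 + n %% c.+2 by exact: divn_eq.
have ltr : n %% c.+2 < c.+2 by rewrite ltn_pmod.
have -> : b = n - a by rewrite /n addKn.
have base : (q - 1) * turan_betti c.+1 (n - q) = turan_betti c.+2 n by [].
have : a <= n by rewrite leq_addr.
clearbody q n; move: (n %% _) n_eq ltr => r n_eq ltr.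
case: (leqP q a) => [/subnKC <- | /ltnW qa _].
  elim: (a - q) => [|d IH] an; first by rewrite addn0 base.
  apply: leq_trans (IH _); last by lia.
  have -> : n - (q + d) = (n - (q + d.+1)).+1 by lia.
  rewrite addnS subSS subn0; apply: turan_betti_shift_le.
  by rewrite -ltnS ltn_divLR //; nia.
have -> : a = q - (q - a) by lia.
elim: (q - a) => [|d IH]; first by rewrite subn0 base.
apply: leq_trans IH.
case: (posnP (q - d - 1)) => [q0|q0].
  by have -> : q - d.+1 - 1 = 0 by lia.
have -> : n - (q - d.+1) = (n - (q - d)).+1 by lia.
rewrite (@turan_betti_shift_eq _ (q - d - 1) (n - (q - d))).
  by apply: leq_trans (leq_addr _ _); rewrite leq_mul2r; apply/orP; right; lia.
rewrite q0 leq_divRL //.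
nia.
Qed.

(** Throughout, D is the degree of the vertex added to the Turan graph on m
    vertices; when c + 2 does not divide m, the largest classes have q + 1
    elements and the others together have D - 1. *)
Section Loss.
Variables (c m : nat).
Hypothesis ndiv : ~~ (c.+2 %| m).
Let q := m %/ c.+2.
Let D := turan_deg c.+2 m.

Lemma ndiv_gt0 : 0 < m. Proof. by case: m ndiv. Qed.

Lemma ndiv_pred_div : m.-1 %/ c.+2 = q.
Proof.
by case: m ndiv_gt0 @q ndiv => //= n _ nd; rewrite divnS // (negbTE nd).
Qed.

Lemma turan_deg_pred : turan_deg c.+2 m.-1 = D.-1.
Proof.
rewrite /turan_deg ndiv_pred_div /D /turan_deg -/q; have := ndiv_gt0; lia.
Qed.

Lemma turan_deg_predS : D = D.-1.+1.
Proof.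
rewrite prednK // /D /turan_deg subn_gt0 ltn_Pdiv //; exact: ndiv_gt0.
Qed.

Lemma turan_deg_pred_div : D.-1 %/ c.+1 = q.
Proof.
rewrite -turan_deg_pred div_turan_deg ?ndiv_pred_div //.
by rewrite prednK // ndiv_gt0.
Qed.

Lemma turan_betti_ceil : turan_betti c.+2 m = q * turan_betti c.+1 D.-1.
Proof.
have qD := turan_deg_pred_div.
case: (posnP q) => q0; first by rewrite turan_bettiS -/q q0.
have mE : m = m.-1.+1 by rewrite prednK // ndiv_gt0.
by rewrite mE turan_betti_step turan_bettiS turan_deg_pred ndiv_pred_div; move: q0; nia.
Qed.

Lemma turan_edges_ceil : turan_edges c.+2 m = turan_edges c.+1 D.-1 + q.+1 * D.-1.
Proof.
have mE : m = m.-1.+1 by rewrite prednK // ndiv_gt0.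
rewrite mE turan_edgesS turan_edges_split turan_deg_pred ndiv_pred_div; lia.
Qed.

Lemma ndiv_decomp : m = q.+1 + D.-1.
Proof.
by have := turan_deg_predS; have := leq_div m c.+2; rewrite /D /turan_deg -/q; lia.
Qed.

(** The complete multipartite graph with a class of m - nu <= q + 1 vertices and
    the others balanced on nu vertices has s edges less than the Turan graph on
    m vertices, and for each missing edge it loses at least the spheres of the
    Turan graph with a largest and a smallest class removed.  For nu = D - 1 it is the
    Turan graph; each further step is [turan_betti_shift_eq], and the loss per
    edge only grows with nu. *)
Lemma multipartite_loss nu : D.-1 <= nu < m ->
  exists s, turan_edges c.+1 nu + (m - nu) * nu + s = turan_edges c.+2 m /\
   (m - 1 - nu) * turan_betti c.+1 nu + s * turan_betti c (turan_deg c.+1 D.-1)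
     <= turan_betti c.+2 m.
Proof.
have mq := ndiv_decomp; have qD := turan_deg_pred_div.
case/andP=> /subnKC <-; elim: (nu - D.-1) => [|d IH]; rewrite ?addn0 ?addnS => lt.
  exists 0; rewrite turan_betti_ceil turan_edges_ceil addn0.
  have -> : m - D.-1 = q.+1 by lia.
  have -> : m - 1 - D.-1 = q by lia.
  by rewrite mul0n addn0.
case: (IH (ltnW lt)) => s [es bs]; move: lt.
set x := D.-1 + d in es bs * => lt.
have qx : q <= x %/ c.+1 by rewrite -qD leq_div2r // leq_addr.
have xx := leq_div x c.+1.
have Dx : D.-1 <= x by exact: leq_addr.
have px : m - 1 - x <= x %/ c.+1 by apply: leq_trans qx; lia.
exists (s + (x %/ c.+1 - (m - 1 - x))); split.
  rewrite -es turan_edgesS /turan_deg.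
  have [p pE] : exists p, m = p + x.+1 by exists (m - x.+1); lia.
  have pE1 : m - 1 - x = p by lia.
  have -> : m - x = p.+1 by lia.
  have -> : m - x.+1 = p by lia.
  rewrite pE1 mulSn mulnS in px *.
  by move: (p * x) (turan_edges _ x) (x %/ c.+1) px xx => px E k px0 xx; lia.
apply: leq_trans bs.
rewrite (@turan_betti_shift_eq _ (m - 1 - x) x); last by rewrite px andbT; lia.
have -> : m - 1 - x.+1 = m - 1 - x - 1 by lia.
rewrite mulnDl -[leqRHS]addnA leq_add2l addnC leq_add2r.
by rewrite leq_mul // leq_turan_betti // leq_turan_deg.
Qed.
End Loss.

Lemma exists_turan_edges_level c a b x : turan_edges c.+1 a < x <= turan_edges c.+1 b ->
  exists nu tau, [/\ a <= nu, nu < b, x = turan_edges c.+1 nu + tau &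
                  0 < tau <= turan_deg c.+1 nu].
Proof.
elim: b => [|b IH]; first by rewrite turan_edges0; lia.
case/andP=> ax xb; case: (leqP x (turan_edges c.+1 b)) => xb'.
  case: IH => [|nu [tau [anu nub xE tE]]]; first by rewrite ax.
  by exists nu, tau; split=> //; exact: ltnW.
exists b, (x - turan_edges c.+1 b); rewrite turan_edgesS in xb; split=> //; try lia.
rewrite leqNgt; apply/negP => ba.
have := @leq_turan_edges c.+1 b.+1 a ba; rewrite turan_edgesS; lia.
Qed.

(** A link with x vertices, in a graph where no link has more than
    [turan_edges c.+2 nu + tau] edges, counted up to the Turan number of its
    size, has at most [phi x] spheres. *)
Section Truncation.
Variables (c nu tau : nat).
Let f := turan_betti c.+2.
Let h := turan_betti c.+1.
Let phi x := minn (f x) (f nu + h tau).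

(** Here z counts the entries d <= nu and i adds up their deficits nu - d.
    Convexity moves all the deficits into a single entry; the entries above nu
    are cut down to nu + 1. *)
Lemma sum_truncated (ds : seq nat) : exists z i,
  [/\ z <= size ds, (0 < z) || (i == 0),
      sumn (map phi ds) + f nu <=
        size ds * f nu + f (nu - i) + (size ds - z) * h tau
    & size ds * nu.+1 <= sumn ds + z + i].
Proof.
elim: ds => [|d ds [z [i [zs zi vs es]]]] /=.
  by exists 0, 0; split=> //; rewrite subn0; lia.
case: (leqP d nu) => dnu.
  exists z.+1, (i + (nu - d)); split=> //; last first.
    by rewrite mulSn; move: es; move: (size ds * _) => k; lia.
  rewrite subSS.
  have := @turan_betti_shift c.+1 (nu - i) nu (nu - d) (leq_subr _ _).
  rewrite subKn // subnDA -/f.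
  have : phi d <= f d by exact: geq_minl.
  by move: vs; rewrite mulSn; move: (size ds * _) (_ * h tau) => k l; lia.
exists z, i; split=> //; first exact: leqW; last first.
  by rewrite mulSn; move: es; move: (size ds * _) => k; lia.
have : phi d <= f nu + h tau by exact: geq_minr.
rewrite subSn // !mulSn; move: vs.
by move: (size ds * _) (_ * h tau) => k l; lia.
Qed.

Lemma truncated0 : phi 0 = 0. Proof. by rewrite /phi /f turan_betti0 min0n. Qed.

(** The left-hand side of the last hypothesis is a lower bound for the number of
    edges of a graph on m + 1 vertices in which some vertex has a link with
    [turan_edges c.+2 nu + tau] edges and at least nu + 1 vertices, and ds are
    the sizes of the links met when its nonneighbours are deleted. *)
Lemma sum_truncated_le m t (ds : seq nat) : ~~ (c.+3 %| m) ->
  (turan_deg c.+3 m).-1 <= nu < m -> tau <= turan_deg c.+2 nu ->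
  size ds <= m - 1 - nu ->
  turan_edges c.+2 nu + tau + nu.+1 + sumn ds <= turan_edges c.+3 m + t ->
  sumn (map phi ds) <= turan_betti c.+3 m + turan_betti c.+2 t.
Proof.
move=> ndiv nuD tau_le sz Eds.
have mq := ndiv_decomp ndiv.
have qD := turan_deg_pred_div ndiv.
have [s [es bs]] := multipartite_loss ndiv nuD.
set D := turan_deg c.+3 m in nuD qD mq bs.
set P := m - 1 - nu in sz bs.
(* Entries 0 stand for missing links: they change neither sum. *)
have [z [i [zs zi vs sums]]] := sum_truncated (ds ++ nseq (P - size ds) 0).
move: zs vs sums; rewrite map_cat sumn_cat sumn_cat size_cat size_nseq subnKC //.
rewrite map_nseq truncated0 sumn_nseq mul0n !addn0 => zs vs sums.
have mE : m - nu = P.+1 by rewrite /P; lia.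
rewrite mE in es.
(* The incomplete vertex sees tau vertices of the balanced part and all of the
   small class, of size P + 1, except for z of its vertices. *)
set b := (P - z).+1 + tau.
have hb : (P - z) * h tau <= f b.
  by have := turan_betti_join c.+1 (P - z).+1 tau; rewrite subSS subn0.
have qnu : m %/ c.+3 <= nu %/ c.+2 by rewrite -qD leq_div2r //; lia.
have tau_le' : tau + nu %/ c.+2 <= nu.
  by move: tau_le (leq_div nu c.+2); rewrite /turan_deg; lia.
have bD : b <= D by have := turan_deg_predS ndiv; rewrite -/D /b; lia.
have binu : (b - s <= nu) || (i == 0).
  case/orP: zi => [z0|->]; last by rewrite orbT.
  by apply/orP; left; rewrite /b; lia.
have bt : b - s - i <= t.
  move: es sums; rewrite mulSn mulnS; move: (P * nu) => k es sums.
  move: zs es sums Eds; rewrite /b; clear.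
  by move: (turan_edges _ _) (turan_edges _ _); lia.
(* Each of the s missing edges pays for one neighbour of the incomplete
   vertex. *)
have fstep : forall k, f b <= f (b - k) + k * h (turan_deg c.+2 D.-1).
  elim=> [|k IH]; first by rewrite subn0 mul0n addn0.
  apply: leq_trans IH _; rewrite mulSn addnA leq_add2r subnS.
  case: (b - k) (leq_subr k b) => [|x] xb; first exact: leq_addr.
  rewrite /f turan_betti_step /= leq_add2l; apply/leq_turan_betti/leq_turan_deg.
  by rewrite -ltnS -(turan_deg_predS ndiv) (leq_trans xb).
have fs := fstep s.
have ft : f (b - s - i) <= f t by exact: leq_turan_betti.
have fi : f (b - s) + f (nu - i) <= f nu + f (b - s - i).
  case/orP: binu => [bs_nu|/eqP->]; first exact: turan_betti_shift.
  by rewrite !subn0 addnC.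
move: bs vs hb fs ft fi; rewrite -/f -/h.
move: (sumn _) (P * _) (_ * h tau) (_ * h _) => S Pf zh sh.
move: (f nu) (f (nu - i)) (f b) (f (b - s)) (f (_ - i)) (f t) (turan_betti _ m).
by clear; lia.
Qed.
End Truncation.

(** * Chains of sets, contraction and extension by a vertex *)

Section Chains.
Local Open Scope ring_scope.
Variables (F : fieldType) (T : finType).
Implicit Types (A B S : {set T}) (u v w : T).

Definition chain := {ffun {set T} -> F^o}.
Implicit Types c z : chain.

(** Interior multiplication by u in the exterior algebra, where a set stands for
    the wedge product of its elements; [extend] is the exterior multiplication.
    With these two, all the signs of the boundary are dealt with once, in the
    (anti)commutation rules below. *)
Definition contract u c : chain :=
  [ffun A : {set T} => if u \in A then 0 else (-1) ^+ vpos A u * c (u |: A)].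
Definition extend u c : chain :=
  [ffun A : {set T} => if u \in A then (-1) ^+ vpos A u * c (A :\ u) else 0].

Fact contract_is_linear u : linear (contract u).
Proof.
move=> a c d; apply/ffunP=> A; rewrite !ffunE.
by case: ifP => _; rewrite ?scaler0 ?addr0 //= mulrDr scalerAr.
Qed.
HB.instance Definition _ u :=
  GRing.isLinear.Build F chain chain _ (contract u) (contract_is_linear u).

Fact extend_is_linear u : linear (extend u).
Proof.
move=> a c d; apply/ffunP=> A; rewrite !ffunE.
by case: ifP => _; rewrite ?scaler0 ?addr0 //= mulrDr scalerAr.
Qed.
HB.instance Definition _ u :=
  GRing.isLinear.Build F chain chain _ (extend u) (extend_is_linear u).

Definition bdry c : chain := \sum_u contract u c.

Fact bdry_is_linear : linear bdry.
Proof.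
move=> a c d; rewrite /bdry scaler_sumr -big_split /=.
by apply: eq_bigr => u _; rewrite linearP.
Qed.
HB.instance Definition _ := GRing.isLinear.Build F chain chain _ bdry bdry_is_linear.

Lemma vposU1 A u v : u \notin A ->
  vpos (u |: A) v = ((enum_rank u < enum_rank v) + vpos A v)%N.
Proof.
move=> uA; rewrite /vpos.
have [lt|ge] := ltnP (enum_rank u) (enum_rank v).
  have -> : [set w in u |: A | (enum_rank w < enum_rank v)%N]
            = u |: [set w in A | (enum_rank w < enum_rank v)%N].
    by apply/setP=> w; rewrite !inE; case: eqP => [->|//]; rewrite lt.
  by rewrite cardsU1 inE (negbTE uA).
rewrite add0n; apply: eq_card => w; rewrite !inE; case: eqP => [->|//].
by rewrite ltnNge ge /= !andbF.
Qed.

Lemma vposU1id A u : vpos (u |: A) u = vpos A u.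
Proof.
apply: eq_card => w; rewrite !inE; case: eqP => [->|//].
by rewrite ltnn !andbF.
Qed.

Lemma vposD1id A u : vpos (A :\ u) u = vpos A u.
Proof.
case: (boolP (u \in A)) => uA; first by rewrite -{2}(setD1K uA) vposU1id.
congr (vpos _ u); apply/setP=> w; rewrite !inE; case: eqP => [->|//].
by rewrite (negbTE uA).
Qed.

(** Exactly one of two distinct vertices precedes the other; this is the source
    of all anticommutation rules. *)
Lemma sign_swap u v : u != v ->
  (-1) ^+ (enum_rank u < enum_rank v)%N = - (-1) ^+ (enum_rank v < enum_rank u)%N :> F.
Proof.
move=> uv; have : enum_rank u != enum_rank v by rewrite (inj_eq enum_rank_inj).
by rewrite -val_eqE; case: ltngtP => //= _ _; rewrite ?expr0 ?expr1 ?opprK.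
Qed.

Lemma contract_contract u c : contract u (contract u c) = 0.
Proof. by apply/ffunP=> A; rewrite !ffunE setU11 mulr0 if_same. Qed.

Lemma contractC u v c :
  contract u (contract v c) = - contract v (contract u c).
Proof.
have [->|uv] := eqVneq u v; first by rewrite contract_contract oppr0.
apply/ffunP=> A; rewrite !ffunE !inE (negbTE uv) eq_sym (negbTE uv) /=.
case: (boolP (u \in A)) => uA; case: (boolP (v \in A)) => vA;
  rewrite ?mulr0 ?oppr0 //.
rewrite !vposU1 // setUCA !exprD !mulrA (sign_swap uv) mulrN !mulNr.
by congr (- (_ * _)); rewrite mulrC mulrA [in RHS]mulrAC.
Qed.

Lemma extend_contract u c : extend u (contract u c) + contract u (extend u c) = c.
Proof.
apply/ffunP=> A; rewrite !ffunE !inE eqxx /=.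
case: (boolP (u \in A)) => uA; rewrite ?add0r ?addr0.
  by rewrite setD1K // vposD1id mulrA -expr2 sqrr_sign mul1r.
by rewrite vposU1id setU1K // mulrA -expr2 sqrr_sign mul1r.
Qed.

Lemma extend_contractN u v c : u != v ->
  extend u (contract v c) = - contract v (extend u c).
Proof.
move=> uv; apply/ffunP=> A; rewrite !ffunE !inE (negbTE uv) eq_sym (negbTE uv) /=.
case: (boolP (u \in A)) => uA; case: (boolP (v \in A)) => vA;
  rewrite ?mulr0 ?oppr0 //.
have [B uB AE] : exists2 B : {set T}, u \notin B & A = u |: B.
  by exists (A :\ u); rewrite ?setD11 // setD1K.
have vB : v \notin B by apply: contra vA; rewrite AE => vB; rewrite !inE vB orbT.
rewrite AE setU1K // setUCA setU1K; last by rewrite !inE negb_or uv.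
rewrite !vposU1id (vposU1 v uB) (vposU1 u vB) !exprD (sign_swap uv).
rewrite !mulNr opprK -!mulrA [in RHS]mulrCA [LHS]mulrCA; congr (_ * _).
by rewrite !mulrA -expr2 sqrr_sign mul1r.
Qed.

Lemma bdry_contract u c : contract u (bdry c) = - bdry (contract u c).
Proof.
rewrite /bdry linear_sum /= -sumrN; apply: eq_bigr => v _.
by rewrite contractC.
Qed.

Lemma bdry_bdry c : bdry (bdry c) = 0.
Proof.
pose G u v := contract u (contract v c).
have Guu u : G u u = 0 by exact: contract_contract.
have GC u v : G u v = - G v u by exact: contractC.
have -> : bdry (bdry c) = \sum_u \sum_v G u v.
  by rewrite /bdry; apply: eq_bigr => u _; rewrite linear_sum.
(* The terms (u, v) and (v, u) cancel. *)
rewrite (eq_bigr (fun u => \sum_(v | (enum_rank u < enum_rank v)%N) G u v -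
                            \sum_(v | (enum_rank v < enum_rank u)%N) G v u)).
  rewrite sumrB; apply/eqP; rewrite subr_eq0; apply/eqP.
  rewrite (exchange_big_dep predT) //=.
move=> u _; rewrite (bigID (fun v => (enum_rank u < enum_rank v)%N)) /=; congr (_ + _).
rewrite (bigD1 u) ?ltnn //= Guu add0r -sumrN; apply: eq_big => v; last by rewrite GC.
by rewrite -leqNgt ltn_neqAle andbC (inj_eq val_inj) (inj_eq enum_rank_inj).
Qed.

(** The cone construction: extension by u is a contracting homotopy. *)
Lemma bdry_extend u c : bdry (extend u c) = c - extend u (bdry c).
Proof.
rewrite /bdry linear_sum /= (bigD1 u) //= [in RHS](bigD1 u) //=.
rewrite opprD addrA -sumrN; congr (_ + _).
  by apply/eqP; rewrite eq_sym subr_eq addrC extend_contract.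
by apply: eq_bigr => v uv; rewrite extend_contractN ?opprK // eq_sym.
Qed.

Definition bdry_lfun : 'End(chain) := linfun bdry.
Definition contract_lfun u : 'End(chain) := linfun (contract u).

Lemma bdry_lfunE c : bdry_lfun c = bdry c. Proof. exact: lfunE. Qed.

Lemma contract_lfunE u c : contract_lfun u c = contract u c.
Proof. exact: lfunE. Qed.

Definition mask_chain (P : pred {set T}) c : chain :=
  [ffun A : {set T} => if P A then 0 else c A].
Fact mask_chain_is_linear P : linear (mask_chain P).
Proof.
move=> a c d; apply/ffunP=> A; rewrite !ffunE.
by case: ifP => _; rewrite ?scaler0 ?addr0.
Qed.
HB.instance Definition _ P :=
  GRing.isLinear.Build F chain chain _ (mask_chain P) (mask_chain_is_linear P).

(** A kernel, so that it is a subspace by construction. *)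
Definition supported (P : pred {set T}) : {vspace chain} :=
  lker (linfun (mask_chain P)).

Lemma supportedP P c : reflect (forall A, ~~ P A -> c A = 0) (c \in supported P).
Proof.
rewrite memv_ker lfunE; apply: (iffP eqP) => [/ffunP H A nA|H].
  by have := H A; rewrite !ffunE (negbTE nA).
by apply/ffunP=> A; rewrite !ffunE; case: ifPn => // /H.
Qed.

Lemma supportedS (P Q : pred {set T}) : subpred P Q -> (supported P <= supported Q)%VS.
Proof.
move=> PQ; apply/subvP=> c /supportedP cP; apply/supportedP=> A nQ; apply: cP.
exact: contra (PQ A) nQ.
Qed.

End Chains.

(** * Homology of flag complexes of induced subgraphs *)

Section Flag.
Local Open Scope ring_scope.
Variables (F : fieldType) (T : finType) (adj : rel T).
Hypotheses (adj_sym : symmetric adj) (adj_irr : irreflexive adj).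
Implicit Types (A B S L : {set T}) (u v w : T) (j : nat).
Local Notation chain := (chain F T).
Implicit Types c z : chain.

Definition nbr S u : {set T} := [set v in S | adj u v].
(** The index j counts vertices, as in [simplices]: these are the simplices of
    dimension j - 1, and j = 0 is the empty simplex. *)
Definition faces S j : pred {set T} :=
  fun A => [&& clique adj A, A \subset S & #|A| == j].

Definition chains S j : {vspace chain} := supported F (faces S j).
Definition cycles S j : {vspace chain} := (chains S j :&: lker (bdry_lfun F T))%VS.
Definition bounds S j : {vspace chain} := (bdry_lfun F T @: chains S j.+1)%VS.
Definition ibetti S j : nat := (\dim (cycles S j) - \dim (bounds S j))%N.

Lemma cliqueP A :
  reflect {in A &, forall x y, x != y -> adj x y} (clique adj A).
Proof.
apply: (iffP forall_inP) => [H x y xA yA xy|H x xA].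
  by have /forall_inP/(_ y yA)/implyP := H x xA; apply.
by apply/forall_inP=> y yA; apply/implyP; exact: H.
Qed.

Lemma faces_setU1 S j u A : u \in S -> u \notin A ->
  faces S j.+1 (u |: A) = faces (nbr S u) j A.
Proof.
move=> uS uA; rewrite /faces cardsU1 uA add1n eqSS subUset sub1set uS /=.
rewrite !andbA; congr (_ && _); apply/andP/andP => [[/cliqueP cl AS]|[/cliqueP cl AS]].
  split.
    by apply/cliqueP=> x y xA yA; apply: cl; rewrite !inE ?xA ?yA orbT.
  apply/subsetP=> x xA; rewrite inE (subsetP AS) //=; apply: cl.
  - by rewrite setU11.
  - by rewrite !inE xA orbT.
  - by apply: contraNneq uA => ->.
split; last by apply: subset_trans AS _; apply/subsetP=> x; rewrite inE => /andP[].
have adjA x : x \in A -> adj u x.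
  by move/(subsetP AS); rewrite inE => /andP[].
apply/cliqueP=> x y /setU1P[->|xA] /setU1P[->|yA]; rewrite ?eqxx //.
- by rewrite adjA.
- by rewrite adj_sym adjA.
- exact: cl.
Qed.

Lemma faces_sub S S' j A : S \subset S' -> faces S j A -> faces S' j A.
Proof.
by move=> SS' /and3P[cl AS cA]; apply/and3P; split=> //; exact: subset_trans SS'.
Qed.

Lemma faces_setU1W S j u A : faces S j.+1 (u |: A) -> u \notin A -> faces S j A.
Proof.
move=> fA uA; have uS : u \in S.
  by case/and3P: fA => _ /subsetP -> //; rewrite setU11.
move: fA; rewrite faces_setU1 //; apply: faces_sub.
by apply/subsetP=> x; rewrite inE => /andP[].
Qed.

Lemma chainsS S S' j : S \subset S' -> (chains S j <= chains S' j)%VS.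
Proof. by move=> SS'; apply: supportedS => A; exact: faces_sub. Qed.

Lemma contract_chains S j u c : u \in S ->
  c \in chains S j.+1 -> contract u c \in chains (nbr S u) j.
Proof.
move=> uS /supportedP cS; apply/supportedP=> A; rewrite ffunE; case: ifPn => // uA.
by rewrite -faces_setU1 // => /cS ->; rewrite mulr0.
Qed.

Lemma bdry_chains S j c : c \in chains S j.+1 -> bdry c \in chains S j.
Proof.
move=> /supportedP cS; apply: rpred_sum => u _; apply/supportedP=> A nA.
rewrite ffunE; case: ifPn => // uA; rewrite cS ?mulr0 //.
by apply: contra nA => /faces_setU1W ->.
Qed.

Lemma extend_chains S L j u c : u \in S -> L \subset nbr S u ->
  c \in chains L j -> extend u c \in chains S j.+1.
Proof.
move=> uS LS /(subvP (chainsS j LS)) /supportedP cS; apply/supportedP=> A.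
rewrite ffunE; case: ifPn => // uA.
by rewrite -{1}(setD1K uA) faces_setU1 ?setD11 // => /cS ->; rewrite mulr0.
Qed.

Lemma contract_chains0 S j u c : u \notin S ->
  c \in chains S j -> contract u c = 0.
Proof.
move=> uS /supportedP cS; apply/ffunP=> A; rewrite !ffunE; case: ifPn => // uA.
rewrite cS ?mulr0 //; apply: contra uS => /and3P[_ /subsetP-> //].
by rewrite setU11.
Qed.

Lemma contract_ker S j u c :
  c \in chains S j -> contract u c = 0 -> c \in chains (S :\ u) j.
Proof.
move=> /supportedP cS /ffunP c0; apply/supportedP=> A nA.
case: (boolP (faces S j A)) => [fA|]; last exact: cS.
have uA : u \in A.
  apply: contraR nA => uA; case/and3P: fA => cl AS /eqP cA.
  by apply/and3P; split=> //; [rewrite subsetD1 AS | rewrite cA].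
have := c0 (A :\ u); rewrite !ffunE setD11 setD1K // => /eqP.
by rewrite mulf_eq0 signr_eq0 => /eqP.
Qed.

Lemma nbr_notin S u : u \notin nbr S u.
Proof. by rewrite inE adj_irr andbF. Qed.

Lemma cyclesP S j c : reflect (c \in chains S j /\ bdry c = 0) (c \in cycles S j).
Proof.
by rewrite memv_cap memv_ker bdry_lfunE; apply: (iffP andP) => -[? /eqP].
Qed.

Lemma boundsP S j c :
  reflect (exists2 d, d \in chains S j.+1 & c = bdry d) (c \in bounds S j).
Proof.
by apply: (iffP memv_imgP) => -[d dS ->]; exists d; rewrite ?bdry_lfunE.
Qed.

Lemma bounds_sub S j : (bounds S j <= cycles S j)%VS.
Proof.
apply/subvP=> _ /boundsP[d dS ->]; apply/cyclesP; rewrite bdry_bdry.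
by split=> //; exact: bdry_chains.
Qed.

Lemma contract_cycles S j u c : u \in S ->
  c \in cycles S j.+1 -> contract u c \in cycles (nbr S u) j.
Proof.
move=> uS /cyclesP[cS c0]; apply/cyclesP; split; first exact: contract_chains.
by apply/eqP; rewrite -oppr_eq0 -bdry_contract c0 linear0.
Qed.

Lemma contract_extend S j u c : u \notin S -> c \in chains S j ->
  contract u (extend u c) = c.
Proof.
move=> uS cS; rewrite -[RHS](extend_contract u) (contract_chains0 uS cS).
by rewrite linear0 add0r.
Qed.

(** Contraction by u is a chain map, up to sign, from the chains of S onto those
    of the link of u; its kernel consists of the chains that avoid u.  Comparing
    dimensions of cycles and of boundaries through it replaces the exact
    sequence of the pair. *)
Lemma ibetti_del S j u : u \in S ->
  (ibetti S j.+1 <= ibetti (S :\ u) j.+1 + ibetti (nbr S u) j)%N.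
Proof.
move=> uS; rewrite /ibetti.
have Z : (\dim (cycles S j.+1) <=
          \dim (cycles (S :\ u) j.+1) + \dim (cycles (nbr S u) j))%N.
  rewrite -(limg_ker_dim (contract_lfun F u)) leq_add // dimvS //; apply/subvP => c.
    rewrite memv_cap memv_ker contract_lfunE => /andP[/cyclesP[cS c0] /eqP ck].
    by apply/cyclesP; split=> //; exact: contract_ker ck.
  by case/memv_imgP=> d dS ->; rewrite contract_lfunE; exact: contract_cycles.
have B : (\dim (bounds (S :\ u) j.+1) + \dim (bounds (nbr S u) j) <=
          \dim (bounds S j.+1))%N.
  rewrite -[leqRHS](limg_ker_dim (contract_lfun F u)) leq_add // dimvS //;
    apply/subvP => c.
    case/boundsP=> d dS ->; rewrite memv_cap memv_ker contract_lfunE; apply/andP; split.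
      apply/boundsP; exists d => //.
      by apply: (subvP (chainsS _ _)) dS; exact: subsetDl.
    by rewrite bdry_contract (contract_chains0 _ dS) ?setD11 // linear0 oppr0.
  case/boundsP=> d dS ->; apply/memv_imgP; exists (- bdry (extend u d)).
    rewrite rpredN; apply/boundsP; exists (extend u d) => //.
    exact: extend_chains dS.
  rewrite linearN /= contract_lfunE bdry_contract opprK.
  by rewrite (contract_extend (nbr_notin S u) dS).
have B1 := dimvS (bounds_sub (S :\ u) j.+1); have B2 := dimvS (bounds_sub (nbr S u) j).
lia.
Qed.

Lemma ibetti_cone S j u : u \in S -> {in S, forall x, x != u -> adj u x} ->
  ibetti S j = 0%N.
Proof.
move=> uS uadj; apply/eqP; rewrite subn_eq0 dimvS //; apply/subvP=> c.
case/cyclesP=> cS c0; apply/boundsP; exists (extend u c).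
  apply/supportedP=> A; rewrite ffunE; case: ifPn => // uA nA.
  move/supportedP: cS => -> //; first by rewrite mulr0.
  apply: contra nA => /and3P[/cliqueP cl AS cA]; apply/and3P; split.
  - have AS' x : x \in A -> x != u -> adj u x.
      move=> xA xu; apply: uadj => //; apply: (subsetP AS).
      by rewrite !inE xu.
    apply/cliqueP=> x y xA yA xy; have [xu|xu] := eqVneq x u.
      by rewrite xu AS' // -xu eq_sym.
    have [yu|yu] := eqVneq y u; first by rewrite yu adj_sym AS'.
    by apply: cl; rewrite // !inE ?xu ?yu.
  - by rewrite -(setD1K uA) subUset sub1set uS.
  - by rewrite (cardsD1 u) uA (eqP cA).
by rewrite bdry_extend c0 linear0 subr0.
Qed.

(** If w dominates u, then a cycle z of the link of u is the image under
    contraction of its suspension [extend u z - extend w z]. *)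
Lemma cycles_twin S j u w : u \in S -> w \in S -> u != w -> ~~ adj u w ->
    {in S, forall x, adj u x -> adj w x} ->
  (\dim (cycles (S :\ u) j.+1) + \dim (cycles (nbr S u) j)
     <= \dim (cycles S j.+1))%N.
Proof.
move=> uS wS uw nuw dom.
have nbw : nbr S u \subset nbr S w.
  by apply/subsetP=> x; rewrite !inE => /andP[xS ux]; rewrite xS dom.
have wnb : w \notin nbr S u by rewrite inE (negbTE nuw) andbF.
rewrite -[leqRHS](limg_ker_dim (contract_lfun F u)) leq_add // dimvS //;
  apply/subvP => c.
  case/cyclesP=> cS c0; rewrite memv_cap memv_ker contract_lfunE.
  rewrite (contract_chains0 _ cS) ?setD11 //.
  rewrite eqxx andbT; apply/cyclesP; split=> //.
  by apply: (subvP (chainsS _ _)) cS; exact: subsetDl.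
case/cyclesP=> cS c0; apply/memv_imgP; exists (extend u c - extend w c).
  apply/cyclesP; split; first by rewrite rpredB // (extend_chains _ _ cS).
  by rewrite linearB /= !bdry_extend c0 !linear0 !addr0 subrr.
rewrite linearB /= !contract_lfunE (contract_extend (nbr_notin S u) cS).
have -> : contract u (extend w c) = 0; last by rewrite subr0.
apply/eqP; rewrite -oppr_eq0 -extend_contractN 1?eq_sym //.
by rewrite (contract_chains0 (nbr_notin S u) cS) linear0.
Qed.

Lemma cyclesS S S' j : S \subset S' -> (\dim (cycles S j) <= \dim (cycles S' j))%N.
Proof.
move=> SS'; apply: dimvS; apply: capvS => //; exact: chainsS.
Qed.

Lemma chains_eq0 S j : (#|S| < j)%N -> chains S j = 0%VS.
Proof.
move=> Sj; apply/eqP; rewrite -subv0; apply/subvP=> c /supportedP c0.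
rewrite memv0; apply/eqP/ffunP=> A; rewrite ffunE c0 //.
apply: contraL Sj => /and3P[_ AS /eqP <-]; rewrite -leqNgt subset_leq_card //.
Qed.

Lemma ibetti_small S j : (#|S| < j)%N -> ibetti S j = 0%N.
Proof. by move=> Sj; rewrite /ibetti /cycles chains_eq0 // cap0v dimv0. Qed.

End Flag.

(** * Comparison with the ranks of the boundary matrices *)

Section MatrixRank.
Local Open Scope ring_scope.
(** Factor M through its row base: the first factor is onto, the second one is
    injective. *)
Lemma dim_mulmxr (F : fieldType) m n (M : 'M[F]_(m, n)) :
  \dim (linfun (mulmxr M : 'rV_m -> 'rV_n) @: fullv) = \rank M.
Proof.
have -> : (linfun (mulmxr M : 'rV_m -> 'rV_n) @: fullv)%VS =
          (linfun (mulmxr (row_base M) : 'rV_(\rank M) -> 'rV_n) @: fullv)%VS.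
  apply/vspaceP=> x; apply/memv_imgP/memv_imgP => -[y _ ->]; rewrite !lfunE /=.
    exists (y *m col_base M); rewrite ?memvf // lfunE /= -mulmxA mulmx_base //.
  have /row_fullP[N NK] := col_base_full M.
  have := mulmxA N (col_base M) (row_base M); rewrite mulmx_base NK mul1mx => NM.
  by exists (y *m N); rewrite ?memvf // lfunE /= -mulmxA NM.
rewrite limg_dim_eq; first by rewrite dimvf dim_matrix [LHS]mul1n.
apply/eqP; rewrite -subv0 capfv; apply/subvP=> x; rewrite memv_ker lfunE /= memv0.
by rewrite mulmx_free_eq0 // row_base_free.
Qed.

End MatrixRank.

Section RowChains.
Local Open Scope ring_scope.
Variables (F : fieldType) (T : finType).
Implicit Types (P : {set {set T}}).

(** Identifies the row vectors on which the boundary matrices act with the chains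
    supported on P. *)
Definition chain_of_row P (v : 'rV[F]_#|P|) : chain F T :=
  [ffun A : {set T} => \sum_i v 0 i * (enum_val i == A)%:R].
Fact chain_of_row_is_linear P : linear (@chain_of_row P).
Proof.
move=> a v w; apply/ffunP=> A; rewrite !ffunE scaler_sumr -big_split /=.
by apply: eq_bigr => i _; rewrite !mxE mulrDl scalerAl.
Qed.
HB.instance Definition _ P :=
  GRing.isLinear.Build F 'rV[F]_#|P| (chain F T) _
    (@chain_of_row P) (@chain_of_row_is_linear P).

Lemma chain_of_rowE P v (i : 'I_#|P|) : chain_of_row v (enum_val i) = v 0 i.
Proof.
rewrite ffunE (bigD1 i) //= eqxx mulr1 big1 ?addr0 // => j ji.
by rewrite (inj_eq enum_val_inj) (negbTE ji) mulr0.
Qed.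

Lemma chain_of_row_notin P v A : A \notin P -> @chain_of_row P v A = 0.
Proof.
move=> nA; rewrite ffunE big1 // => i _; case: eqP => [iA|]; last by rewrite mulr0.
by case/negP: nA; rewrite -iA enum_valP.
Qed.

Lemma chain_of_row_inj P : injective (@chain_of_row P).
Proof. by move=> v w vw; apply/rowP=> i; rewrite -!chain_of_rowE vw. Qed.

Lemma chain_of_row_img P :
  (linfun (@chain_of_row P) @: fullv)%VS = supported F (fun A => A \in P).
Proof.
apply/vspaceP=> c; apply/memv_imgP/supportedP => [[v _ ->] A nA|c0].
  by rewrite lfunE chain_of_row_notin.
exists (\row_i c (enum_val i)); rewrite ?memvf // lfunE; apply/ffunP=> A.
case: (boolP (A \in P)) => AP; last by rewrite chain_of_row_notin // c0.
by rewrite -(enum_rankK_in AP AP) chain_of_rowE mxE.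
Qed.

Lemma chain_of_row_dim P (U : {vspace 'rV[F]_#|P|}) :
  \dim (linfun (@chain_of_row P) @: U) = \dim U.
Proof.
apply: limg_dim_eq; apply/eqP; rewrite -subv0; apply/subvP=> v.
rewrite memv_cap memv_ker lfunE memv0 => /andP[_ /eqP v0].
by apply/eqP; apply: chain_of_row_inj; rewrite v0 linear0.
Qed.

Lemma dim_supported P : \dim (supported F (fun A => A \in P)) = #|P|.
Proof. by rewrite -chain_of_row_img chain_of_row_dim dimvf dim_matrix [LHS]mul1n. Qed.

End RowChains.

Section Translate.
Local Open Scope ring_scope.
Variables (F : fieldType) (T : finType) (adj : rel T).
Hypothesis adj_sym : symmetric adj.
Let K := flag_complex adj.
Local Notation M := (boundary F K).

Lemma mem_simplices j A : (A \in simplices K j) = faces adj setT j A.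
Proof. by rewrite !inE /faces subsetT. Qed.

Lemma chains_simplices j :
  chains F adj setT j = supported F (fun A => A \in simplices K j).
Proof.
by apply/eqP; rewrite eqEsubv; apply/andP; split; apply: supportedS => A;
   rewrite mem_simplices.
Qed.

Lemma dim_chains j : \dim (chains F adj setT j) = #|simplices K j|.
Proof. by rewrite chains_simplices dim_supported. Qed.

Lemma incidenceE (A B : {set T}) :
  incidence F A B = \sum_(u | u \notin B) (-1) ^+ vpos B u * (A == u |: B)%:R.
Proof.
rewrite /incidence [RHS](bigID (fun u => A == u |: B)) /= [X in _ + X]big1 ?addr0.
  apply: eq_big => [u|u /andP[uA /eqP <-]].
    apply/andP/andP => [[uA /eqP <-]|[uB /eqP->]].
      by rewrite setD11 setD1K.
    by rewrite setU11 setU1K.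
  by rewrite setD1K // eqxx mulr1 vposD1id.
by move=> u /andP[_ /negbTE ->]; rewrite mulr0.
Qed.

Lemma bdry_chain_of_row j (v : 'rV[F]_#|simplices K j.+1|) :
  bdry (chain_of_row v) = chain_of_row (v *m M j).
Proof.
apply/ffunP=> B.
have -> : bdry (chain_of_row v) B = \sum_i v 0 i * incidence F (enum_val i) B.
  rewrite /bdry sum_ffunE.
  under [RHS]eq_bigr => i _ do rewrite incidenceE mulr_sumr.
  rewrite exchange_big /= [RHS]big_mkcond /=; apply: eq_bigr => u _.
  rewrite !ffunE; case: ifP => //= _; rewrite mulr_sumr; apply: eq_bigr => i _.
  by rewrite mulrCA.
case: (boolP (B \in simplices K j)) => BP.
  rewrite -(enum_rankK_in BP BP) chain_of_rowE mxE.
  by apply: eq_bigr => i _; rewrite mxE.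
rewrite chain_of_row_notin // big1 // => i _; rewrite incidenceE big1 ?mulr0 // => u uB.
case: eqP => [iE|]; last by rewrite mulr0.
case/negP: BP; rewrite mem_simplices; apply: (faces_setU1W adj_sym _ uB).
by rewrite -iE -mem_simplices enum_valP.
Qed.

Lemma dim_bounds j : \dim (bounds F adj setT j) = \rank (M j).
Proof.
rewrite /bounds chains_simplices -chain_of_row_img -limg_comp -dim_mulmxr.
rewrite -(chain_of_row_dim (P := simplices K j)).
rewrite -limg_comp; congr (\dim (_ @: _)); apply/lfunP=> v.
by rewrite !comp_lfunE bdry_lfunE !lfunE bdry_chain_of_row.
Qed.

Lemma boundary_boundary j : M j.+1 *m M j = 0.
Proof.
apply/row_matrixP=> i; rewrite row0 rowE mulmxA; apply: chain_of_row_inj.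
by rewrite -!bdry_chain_of_row bdry_bdry linear0.
Qed.

Lemma bettiE k : betti F K k = ibetti F adj setT k.+1.
Proof.
rewrite /betti /homology /ibetti dim_bounds.
have BZ : (kermx (M k) :&: kermx (cokermx (M k.+1)) == M k.+1)%MS.
  apply/andP; split.
    by apply: submx_trans (capmxSr _ _) _; rewrite submxE mulmx_ker.
  rewrite sub_capmx; apply/andP; split; apply/sub_kermxP; last exact: mulmx_coker.
  exact: boundary_boundary.
have := mxrank_mul_ker (kermx (M k)) (cokermx (M k.+1)).
rewrite (eqmx_rank BZ) mxrank_ker.
have := limg_ker_dim (bdry_lfun F T) (chains F adj setT k.+1).
rewrite -/(bounds F adj setT k) -/(cycles F adj setT k.+1) dim_bounds dim_chains.
move=> nE rE; apply: (canRL (addnK _)); rewrite [LHS]rE -[X in (X - _)%N]nE.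
by rewrite addnK.
Qed.
End Translate.

(** * The upper bound in terms of vertices and edges *)

Section Upper.
Variables (F : fieldType) (T : finType) (adj : rel T).
Hypotheses (adj_sym : symmetric adj) (adj_irr : irreflexive adj).
Implicit Types (S L : {set T}) (u v w : T).
Local Notation ibetti := (ibetti F adj).
Local Notation nbr := (nbr adj).

Definition induced_edges S := #|[set A in edges adj | A \subset S]|.

Lemma edgesP A : reflect (exists x y, adj x y /\ A = [set x; y]) (A \in edges adj).
Proof.
apply: (iffP imsetP) => [[[x y]]|[x [y [xy ->]]]]; last by exists (x, y); rewrite ?inE.
by rewrite inE /= => xy ->; exists x, y.
Qed.

Lemma induced_edges_setT : induced_edges setT = #|edges adj|.
Proof. by apply: eq_card => A; rewrite inE subsetT andbT. Qed.

Lemma induced_edgesS S S' : S \subset S' -> induced_edges S <= induced_edges S'.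
Proof.
move=> SS'; apply/subset_leq_card/subsetP=> A; rewrite !inE => /andP[-> AS].
exact: subset_trans AS SS'.
Qed.

Lemma set2_inj u : injective (fun v => [set u; v]).
Proof.
move=> v w E.
have : v \in [set u; w] by rewrite -E set22.
have : w \in [set u; v] by rewrite E set22.
by rewrite !inE => /orP[/eqP->|/eqP->//] /orP[/eqP->|/eqP->].
Qed.

Lemma induced_edges_del S u : u \in S ->
  induced_edges S = induced_edges (S :\ u) + #|nbr S u|.
Proof.
move=> uS; rewrite -(card_imset _ (@set2_inj u)).
rewrite /induced_edges -[LHS](cardsID [set A : {set T} | u \notin A]); congr (_ + _).
  apply: eq_card => A; rewrite !inE subsetD1 -!andbA; congr (_ && _).
apply: eq_card => A; rewrite !inE negbK; apply/andP/imsetP.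
  case=> uA /andP[/edgesP[x [y [xy AE]]] AS]; move: uA; rewrite AE !inE.
  have [xS yS] : x \in S /\ y \in S.
    by split; apply: (subsetP AS); rewrite AE !inE eqxx ?orbT.
  case/orP=> /eqP->; first by exists y; rewrite // inE yS.
  by exists x; rewrite ?inE ?xS 1?adj_sym // setUC.
case=> x; rewrite inE => /andP[xS ux] ->; split; first by rewrite !inE eqxx.
apply/andP; split; first by apply/edgesP; exists u, x.
by rewrite subUset !sub1set uS.
Qed.

Lemma nbr_sub S u : nbr S u \subset S.
Proof. by apply/subsetP=> x; rewrite inE => /andP[]. Qed.

Lemma nbrS S S' u : S \subset S' -> nbr S u \subset nbr S' u.
Proof.
by move=> SS'; apply/subsetP=> x; rewrite !inE => /andP[/(subsetP SS') -> ->].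
Qed.

(** Induction on S: a removed vertex takes its degree twice, once for itself and
    once for its neighbours. *)
Lemma handshake S : \sum_(u in S) #|nbr S u| = (induced_edges S).*2.
Proof.
have [n le_n] := ubnP #|S|; elim: n S le_n => // n IH S.
have [-> _|[u uS]] := set_0Vmem S.
  rewrite big_set0; apply/esym/eqP; rewrite double_eq0 cards_eq0 -subset0.
  apply/subsetP=> A; rewrite !inE => /andP[/edgesP[x [y [_ ->]]]].
  by rewrite subUset sub1set inE.
rewrite (cardsD1 u) uS ltnS => le_n.
have {}IH := IH _ le_n.
rewrite (induced_edges_del uS) doubleD -IH (big_setD1 u uS) /= addnC -addnn addnA.
congr (_ + _).
have -> : #|nbr S u| = \sum_(w in S :\ u) adj w u.
  rewrite -sum1_card big_mkcond [RHS]big_mkcond /=; apply: eq_bigr => w _.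
  rewrite !inE; case: eqP => [->|_]; first by rewrite adj_irr andbF.
  by case: (w \in S); rewrite //= adj_sym; case: adj.
rewrite -big_split /=; apply: eq_bigr => w _.
rewrite (cardsD1 u (nbr S w)) inE uS /= addnC; congr (_ + _).
by apply: eq_card => x; rewrite !inE andbA.
Qed.

Lemma chains0_le S : \dim (chains F adj S 0) <= 1.
Proof.
apply: leq_trans (dimvS (_ : _ <= supported F (fun A => A \in [set set0]))%VS) _.
  by apply: supportedS => A /and3P[_ _]; rewrite cards_eq0 inE.
by rewrite dim_supported cards1.
Qed.

(** The entries of ds are the degrees of the nonneighbours of v at the time of
    their deletion.  What is left in the end is a cone with apex v. *)
Lemma remove_nonneighbours (phi : nat -> nat) S v j : v \in S ->
    {in S, forall w L, L \subset nbr S w -> ibetti L j <= phi #|L|} ->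
  exists ds : seq nat, [/\ size ds = #|S| - 1 - #|nbr S v|,
     ibetti S j.+1 <= sumn (map phi ds)
   & induced_edges S = sumn ds + #|nbr S v| + induced_edges (nbr S v)].
Proof.
have [n le_n] := ubnP #|S|; elim: n S le_n => // n IH S le_n vS hphi.
have [W0|[w]] := set_0Vmem [set w in S | (w != v) && ~~ adj v w].
  have vadj : {in S, forall x, x != v -> adj v x}.
    move=> x xS xv; apply: contraT => nvx.
    by have := in_set0 x; rewrite -W0 inE xS xv nvx.
  have SD : S :\ v = nbr S v.
    apply/setP=> x; rewrite !inE; case: eqP => [->|/eqP xv]; rewrite ?adj_irr ?andbF //.
    by case: (boolP (x \in S)) => //= xS; rewrite vadj.
  exists [::]; split=> /=.
  - by rewrite -SD (cardsD1 v S) vS; lia.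
  - by rewrite (ibetti_cone _ adj_sym _ vS).
  - by rewrite (induced_edges_del vS) SD add0n addnC.
rewrite inE => /and3P[wS wv nvw].
have vS' : v \in S :\ w by rewrite !inE eq_sym wv.
have nbv : nbr (S :\ w) v = nbr S v.
  apply/setP=> x; rewrite !inE; case: eqP => [->|//].
  by rewrite (negbTE nvw) !andbF.
have SS' : S :\ w \subset S := subsetDl _ _.
have cS := cardsD1 w S; rewrite wS in cS.
have cv : #|nbr S v| < #|S :\ w|.
  rewrite (cardsD1 v (S :\ w)) vS' ltnS -nbv; apply/subset_leq_card.
  rewrite subsetD1 nbr_sub; exact: nbr_notin.
case: (IH (S :\ w)) => // [|x xS L Lx|ds [sz bs es]].
- by rewrite -ltnS (leq_trans _ le_n) // cS.
- by apply: (hphi x); [apply: (subsetP SS') | apply: subset_trans Lx (nbrS _ SS')].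
exists (#|nbr S w| :: ds); split=> /=.
- by rewrite sz nbv cS; lia.
- apply: leq_trans (ibetti_del F adj_sym adj_irr j wS) _; rewrite addnC.
  by rewrite leq_add // (hphi w).
- by rewrite (induced_edges_del wS) es nbv; lia.
Qed.

(** With D the maximal degree, |S| - 1 - D nonneighbours are deleted,
    each with a link on at most D vertices; this is the count of spheres for a
    class of |S| - D vertices joined to a Turan graph on the D others. *)
Lemma ibetti_vertices S j : ibetti S j <= turan_betti j #|S|.
Proof.
elim: j S => [|j IH] S.
  apply: leq_trans (leq_subr _ _) (leq_trans _ (chains0_le S)).
  by rewrite dimvS // capvSl.
have [->|[v0 v0S]] := set_0Vmem S; first by rewrite ibetti_small ?cards0.
case: (@arg_maxnP _ v0 (fun v => v \in S) (fun v => #|nbr S v|) v0S) => v vS vmax.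
have [|ds [sz bs _]] :=
  @remove_nonneighbours (fun _ => turan_betti j #|nbr S v|) S v j vS.
  move=> w wS L Lw; apply: leq_trans (IH L) _; apply: leq_turan_betti.
  by apply: leq_trans (subset_leq_card Lw) _; exact: vmax.
apply: leq_trans bs _.
have -> : sumn [seq turan_betti j #|nbr S v| | _ <- ds] =
          size ds * turan_betti j #|nbr S v|.
  by elim: (ds) => //= d ds' ->; rewrite mulSn.
have le_nb : #|nbr S v| <= #|S| by exact/subset_leq_card/nbr_sub.
have := turan_betti_join j (#|S| - #|nbr S v|) #|nbr S v|; rewrite subnK //.
by rewrite sz subnAC.
Qed.

Definition edge_bound c S := forall m t, t <= turan_deg c.+2 m ->
  induced_edges S <= turan_edges c.+2 m + t ->
  ibetti S c.+2 <= turan_betti c.+2 m + turan_betti c.+1 t.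

(** The first alternative comes from the deletion of a vertex of minimal degree;
    the second one lists what is known when this deletion is too costly. *)
Lemma edge_bound_or_regular c S m t :
    (forall u, u \in S -> edge_bound c (S :\ u)) ->
    t <= turan_deg c.+2 m -> induced_edges S <= turan_edges c.+2 m + t ->
  ibetti S c.+2 <= turan_betti c.+2 m + turan_betti c.+1 t \/
  [/\ 0 < c, 0 < t < turan_deg c.+2 m, ~~ (c.+2 %| m), #|S| = m.+1 &
      exists u, [/\ u \in S, #|nbr S u| = turan_deg c.+2 m &
        {in S, forall w, turan_deg c.+2 m <= #|nbr S w|}]].
Proof.
move=> IHS tD eS.
case: (leqP #|S| m) => [Sm|mS].
  left; apply: leq_trans (ibetti_vertices _ _) _.
  by apply: leq_trans (leq_turan_betti _ Sm) (leq_addr _ _).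
have /set0Pn[v0 v0S] : S != set0 by rewrite -card_gt0; lia.
case: (@arg_minnP _ v0 (fun v => v \in S) (fun v => #|nbr S v|) v0S) => u uS umin.
set d := #|nbr S u| in umin.
have eD : induced_edges S = induced_edges (S :\ u) + d := induced_edges_del uS.
have bD : ibetti S c.+2 <= ibetti (S :\ u) c.+2 + turan_betti c.+1 d.
  apply: leq_trans (ibetti_del F adj_sym adj_irr _ uS) _.
  by rewrite leq_add2l ibetti_vertices.
have hs : #|S| * d <= (induced_edges S).*2.
  by rewrite -handshake -sum_nat_const; apply: leq_sum => w wS; exact: umin.
have ex := turan_edges_exact c.+1 m.
set D := turan_deg c.+2 m in tD ex *.
have Dm : D <= m := turan_deg_le _ _.
(* The exact formula for the Turan edges serves to exclude the case of two
   classes, c = 0. *)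
have hs1 : #|S| * d + m %% c.+2 * (m %/ c.+2).+1 <= m * D + t.*2.
  by rewrite -ex; move: (_ %% _ * _) => z; lia.
have hs2 : m.+1 * d <= #|S| * d by rewrite leq_mul2r mS orbT.
case: (leqP d t) => [dt|td].
  left; apply: leq_trans bD _.
  have := IHS u uS m (t - d); rewrite -/D (leq_trans (leq_subr _ _) tD) => /(_ isT).
  have -> : induced_edges (S :\ u) <= turan_edges c.+2 m + (t - d) by lia.
  move=> /(_ isT); have := turan_betti_superadd c (t - d) d; rewrite subnK //; lia.
(* Otherwise m + 1 vertices of degree D + 1 would have too many edges. *)
have dD : d <= D.
  rewrite leqNgt; apply/negP => Dd.
  have : m.+1 * D.+1 <= m.+1 * d by rewrite leq_mul2l Dd orbT.
  rewrite mulSn mulnS => h; move: h hs1 hs2.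
  by move: (m * D) (m.+1 * d) (#|S| * d) (_ %% _ * _) => x y z w; lia.
have m_gt0 : 0 < m by lia.
have mE : m = m.-1.+1 by rewrite prednK.
case: (leqP d (turan_deg c.+2 m.-1)) => [dD'|D'd].
  left; apply: leq_trans bD _.
  have := IHS u uS m.-1 (turan_deg c.+2 m.-1 + t - d).
  have -> : turan_deg c.+2 m.-1 + t - d <= turan_deg c.+2 m.-1 by lia.
  have -> : induced_edges (S :\ u) <=
            turan_edges c.+2 m.-1 + (turan_deg c.+2 m.-1 + t - d).
    move: eS; rewrite mE turan_edgesS /= eD; lia.
  move=> /(_ isT isT).
  have := @turan_betti_convex c t d (turan_deg c.+2 m.-1 - d) (ltnW td).
  rewrite subnKC // mE turan_betti_step /= addnBA // [t + _]addnC; lia.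
have ndiv : ~~ (c.+2 %| m).
  apply/negP=> dv; move: D'd; rewrite ltnNge; case/negP.
  by move: dD; rewrite /D [in turan_deg _ m]mE turan_degS -mE dv.
have dE : d = D.
  have := turan_degS c.+1 m.-1; rewrite -mE (negbTE ndiv) -/D; lia.
right; rewrite dE in hs1 hs2 td umin *; split=> //.
(* For two classes, m is odd and all degrees are at least D = m / 2 + 1, which
   forces t >= D. *)
- case: c @D {IHS eS eD bD tD ex D'd dE m_gt0 mE dD umin} ndiv td hs1 hs2 Dm => //.
  rewrite dvdn2 negbK => D m_odd td; rewrite modn2 m_odd mul1n.
  have -> : (m %/ 2).+1 = D.
    by rewrite /D /turan_deg divn2; have := odd_double_half m; rewrite m_odd; lia.
  by rewrite mulSn; move: (m * D) (#|S| * D) => x y; lia.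
- rewrite td andbT lt0n; apply/eqP => t0; move: hs1 hs2; rewrite t0 mulSn.
  by move: (m * D) (#|S| * D) (_ %% _ * _) => x y z; lia.
- apply/eqP; rewrite eqn_leq mS andbT leqNgt; apply/negP => S_gt.
  have : m.+2 * D <= #|S| * D by rewrite leq_mul2r S_gt orbT.
  rewrite !mulSn; move: hs1.
  by move: (m * D) (#|S| * D) (_ %% _ * _) => x y z; lia.
- by exists u; split.
Qed.

Section Links.
Variables (c : nat).
Hypothesis IHc : forall S, edge_bound c S.

(** Truncation at the Turan number makes a link with many edges have many
    vertices as well. *)
Definition link_edges S w :=
  minn (induced_edges (nbr S w)) (turan_edges c.+2 #|nbr S w|).

(** The edges of the link are bounded by induction; when the minimum is attained
    by the Turan number of its size, the link has at most nu vertices, or nu + 1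
    when tau is as large as possible. *)
Lemma link_bound S w L nu tau : L \subset nbr S w -> tau <= turan_deg c.+2 nu ->
  link_edges S w <= turan_edges c.+2 nu + tau ->
  ibetti L c.+2 <= turan_betti c.+2 nu + turan_betti c.+1 tau.
Proof.
move=> Lw tau_le; rewrite geq_min => /orP[ew|dw].
  by apply: IHc => //; apply: leq_trans ew; exact: induced_edgesS.
apply: leq_trans (ibetti_vertices _ _) _.
apply: leq_trans (leq_turan_betti _ (subset_leq_card Lw)) _.
move: dw; move: #|nbr S w| => d dw.
case: (leqP d nu) => [dnu|nud].
  by apply: leq_trans (leq_turan_betti _ dnu) (leq_addr _ _).
have e1 := turan_edgesS c.+2 nu.
have tau_eq : tau = turan_deg c.+2 nu by have := leq_turan_edges c.+2 nud; lia.
rewrite tau_eq -turan_betti_step; apply: leq_turan_betti.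
rewrite leqNgt; apply/negP => dnu.
have := leq_turan_edges c.+2 dnu; have := turan_edgesS c.+2 nu.+1.
have := @turan_deg_gt0 c nu.+1 isT; lia.
Qed.

Lemma edge_bound_step S : (forall u, u \in S -> edge_bound c.+1 (S :\ u)) ->
  edge_bound c.+1 S.
Proof.
move=> IHS m t tD eS.
case: (edge_bound_or_regular IHS tD eS) => // -[_ /andP[t_gt0 tltD] ndiv cS].
case=> u [uS du Dmin].
have mE : m = m.-1.+1 by rewrite prednK // (ndiv_gt0 ndiv).
have Dp : turan_deg c.+3 m.-1 = (turan_deg c.+3 m).-1 := turan_deg_pred ndiv.
have DS := turan_deg_predS ndiv.
have eD := induced_edges_del uS; rewrite du in eD.
set D := turan_deg c.+3 m in tD tltD du Dmin Dp DS eD.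
case: (@arg_maxnP _ u (fun v => v \in S) (link_edges S) uS) => v vS vmax.
case: (leqP (link_edges S v) (turan_edges c.+2 D.-1)) => [small|big].
  apply: leq_trans (ibetti_del F adj_sym adj_irr _ uS) _.
  (* The link of u has at most as many spheres as if u had degree D - 1. *)
  have lb := @link_bound S u (nbr S u) D.-1 0 (subxx _) isT.
  have {lb} := lb (leq_trans (vmax _ uS) (leq_trans small (leq_addr _ _))).
  rewrite turan_betti0 addn0 => lb.
  have := IHS u uS m.-1 t; rewrite Dp -ltnS -DS => /(_ tltD).
  have -> : induced_edges (S :\ u) <= turan_edges c.+3 m.-1 + t.
    by move: eS; rewrite eD mE turan_edgesS /= Dp; lia.
  by move=> /(_ isT); rewrite [in turan_betti c.+3 m]mE turan_betti_step Dp; lia.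
have := @exists_turan_edges_level c.+1 D.-1 #|nbr S v| (link_edges S v).
rewrite big geq_minr => /(_ isT)[nu [tau [Dnu nub leE /andP[tau_gt0 tau_le]]]].
pose phi x := minn (turan_betti c.+2 x) (turan_betti c.+2 nu + turan_betti c.+1 tau).
have [|ds [sz bs es]] := @remove_nonneighbours phi S v c.+2 vS.
  move=> w wS L Lw; rewrite leq_min ibetti_vertices (link_bound Lw tau_le) //.
  by rewrite -leE; exact: vmax.
apply: leq_trans bs _.
have vc : #|nbr S v| < #|S|.
  rewrite (cardsD1 v S) vS ltnS; apply: subset_leq_card.
  by rewrite subsetD1 nbr_sub nbr_notin.
apply: (sum_truncated_le (nu := nu) (tau := tau)) => //.
- by rewrite Dnu /=; lia.
- by rewrite sz; lia.
- apply: leq_trans eS; rewrite es -leE.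
  have : link_edges S v <= induced_edges (nbr S v) by exact: geq_minl.
  lia.
Qed.
End Links.

Theorem ibetti_edges c S : edge_bound c S.
Proof.
elim: c S => [|c IHc] S.
all: have [n le_n] := ubnP #|S|; elim: n S le_n => // n IH S le_n.
all: have del u : u \in S -> #|S :\ u| < n
       by move=> uS; move: le_n; rewrite (cardsD1 u S) uS.
  move=> m t tD eS.
  by case: (edge_bound_or_regular (fun u uS => IH _ (del u uS)) tD eS) => // -[].
by apply: (edge_bound_step IHc) => u uS; exact: IH (del u uS).
Qed.

End Upper.

(** * Homology of complete multipartite graphs *)

Section Lower.
Variables (F : fieldType) (T : finType) (adj : rel T).
Hypotheses (adj_sym : symmetric adj) (adj_irr : irreflexive adj).
Implicit Types (S R : {set T}) (u v w x y : T).
Local Notation z S j := (\dim (cycles F adj S j)).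

(** The empty simplex is the only one without vertices, and it is a cycle. *)
Lemma cycles0 S : z S 0 = 1.
Proof.
suff -> : cycles F adj S 0 = supported F (fun A => A \in [set set0]).
  by rewrite dim_supported cards1.
apply/vspaceP=> c; apply/cyclesP/supportedP => [[/supportedP cS _] A|c0].
  rewrite inE => nA; apply: cS; apply: contra nA => /and3P[_ _].
  by rewrite cards_eq0.
split.
  apply/supportedP=> A nA; apply: c0; rewrite inE; apply: contra nA => /eqP->.
  rewrite /faces sub0set cards0 eqxx !andbT.
  by apply/cliqueP=> x y; rewrite inE.
apply/ffunP=> A; rewrite /bdry sum_ffunE !ffunE big1 // => u _; rewrite ffunE.
case: ifP => // _; rewrite c0 ?GRing.mulr0 // inE; apply/set0Pn; exists u.
exact: setU11.
Qed.

(** R is a full class: its vertices have equal neighbourhoods, so that each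
    vertex but the last one can be split off with [cycles_twin]. *)
Lemma cycles_class S R j : R \subset S ->
    {in R & S, forall x y, adj x y = (y \notin R)} ->
  (#|R| - 1) * z (S :\: R) j <= z S j.+1.
Proof.
have [n le_n] := ubnP #|R|; elim: n S R le_n => // n IH S R le_n RS RE.
have [->|[u uR]] := set_0Vmem R; first by rewrite cards0.
have [R0|[w wR]] := set_0Vmem (R :\ u); first by rewrite (cardsD1 u) uR R0 cards0.
have uS := subsetP RS _ uR.
have [wu wR'] := setD1P wR.
have wS := subsetP RS _ wR'.
have nbE : nbr adj S u = S :\: R.
  apply/setP=> x; rewrite !inE andbC.
  by case: (boolP (x \in S)) => xS; rewrite ?andbF // !andbT RE.
have dom : {in S, forall x, adj u x -> adj w x} by move=> x xS; rewrite !RE.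
have := cycles_twin F adj_sym adj_irr j uS wS _ _ dom.
rewrite eq_sym wu RE // wR' nbE => /(_ isT isT); apply: leq_trans.
have SRE : (S :\ u) :\: (R :\ u) = S :\: R.
  by apply/setP=> x; rewrite !inE; case: eqP => [->|]; rewrite ?uR.
have := IH (S :\ u) (R :\ u); rewrite SRE (cardsD1 u R) uR add1n.
have -> : #|R :\ u| < n by move: le_n; rewrite (cardsD1 u R) uR.
have c0 : 0 < #|R :\ u| by apply/card_gt0P; exists w.
rewrite setSD // => /(_ isT isT) h.
have {}h := h _; apply: leq_trans (leq_add (h _) (leqnn _)).
  by rewrite -mulSnr leq_mul2r; apply/orP; right; lia.
move=> x y /setD1P[xu xR] /setD1P[yu yS].
by rewrite RE // !inE yu.
Qed.

Lemma card_fibers (I : finType) (J : {set I}) (col : T -> I) S :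
    {in S, forall x, col x \in J} ->
  #|S| = \sum_(a in J) #|[set x in S | col x == a]|.
Proof.
move=> SJ; rewrite -sum1_card (partition_big col (mem J)) //=.
by apply: eq_bigr => a _; rewrite -sum1_card; apply: eq_bigl => x; rewrite inE.
Qed.

(** A smallest class has [#|S| %/ j] elements, and splitting it off follows the
    recursion of [turan_betti]. *)
Lemma cycles_balanced (I : finType) (col : T -> I) j S (J : {set I}) :
    #|J| = j -> {in S, forall x, col x \in J} ->
    {in S &, forall x y, adj x y = (col x != col y)} ->
    {in J &, forall a b,
      #|[set x in S | col x == a]| <= #|[set x in S | col x == b]|.+1} ->
  turan_betti j #|S| <= z S j.
Proof.
elim: j S J => [|j IH] S J cJ SJ SE bal; first by rewrite cycles0.
have /set0Pn[a0 a0J] : J != set0 by rewrite -card_gt0 cJ.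
pose fib a := [set x in S | col x == a].
case: (@arg_minnP _ a0 (fun a => a \in J) (fun a => #|fib a|) a0J) => a aJ amin.
set R := fib a; have RS : R \subset S by apply/subsetP=> x; rewrite inE => /andP[].
have cS := card_fibers SJ.
have sE : #|S| %/ j.+1 = #|R|.
  apply/eqP; rewrite eqn_leq leq_divRL // -ltnS ltn_divLR //; apply/andP; split.
    rewrite cS (big_setD1 a aJ) /= mulnC -/R -cJ (cardsD1 a J) aJ add1n.
    have : \sum_(b in J :\ a) #|fib b| <= #|J :\ a| * #|R|.+1.
      rewrite -sum_nat_const; apply: leq_sum => b /setD1P[_ bJ]; exact: bal.
    by move/(leq_add (leqnn #|R|))/leq_ltn_trans; apply; nia.
  rewrite cS -cJ mulnC -sum_nat_const; apply: leq_sum => b bJ; exact: amin.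
rewrite turan_bettiS /turan_deg sE.
have RE : {in R & S, forall x y, adj x y = (y \notin R)}.
  move=> x y; rewrite !inE => /andP[xS /eqP xa] yS.
  by rewrite SE // xa yS /= eq_sym.
apply: leq_trans (cycles_class j RS RE); rewrite leq_mul //.
have -> : #|S| - #|R| = #|S :\: R| by rewrite cardsD (setIidPr RS).
apply: (IH _ (J :\ a)).
- by have := cardsD1 a J; rewrite aJ cJ add1n => -[].
- move=> x; rewrite !inE => /andP[].
  by case: (boolP (x \in S)) => //= xS xa _; rewrite xa SJ.
- by move=> x y /setDP[xS _] /setDP[yS _]; exact: SE.
have fibE b : b != a -> [set x in S :\: R | col x == b] = fib b.
  move=> ba; apply/setP=> x; rewrite !inE; case: (x \in S) => //=.
  by case: (eqVneq (col x) b) => [->|]; rewrite ?andbF // ba.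
move=> b b' /setD1P[ba bJ] /setD1P[ba' bJ'].
by rewrite !fibE //; exact: bal.
Qed.

Lemma ibetti_cycles S j : chains F adj S j.+1 = 0%VS -> ibetti F adj S j = z S j.
Proof. by move=> c0; rewrite /ibetti /bounds c0 limg0 dimv0 subn0. Qed.
End Lower.

Lemma card_residue r m a : a < r.+1 ->
  \sum_(i < m) (i %% r.+1 == a) = m %/ r.+1 + (a < m %% r.+1).
Proof.
move=> ar; elim: m => [|m IH]; first by rewrite big_ord0 div0n mod0n.
rewrite big_ord_recr /= IH divnS // modnS; case: ifP => dv /=; last by lia.
have -> : m %% r.+1 = r.
  have := divn_eq m.+1 r.+1; have := divn_eq m r.+1.
  by rewrite divnS // modnS dv /= addn0 => {1}->; rewrite mulSn; lia.
lia.
Qed.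

(** * The extremal graph *)

Section Extremal.
Variables (n c e : nat).
Local Notation r := c.+2.
Local Notation V := 'I_n.
Let first_edges := take e (turan_edge_list n r).
Let H := H_graph n r e.

Definition residue (i : V) : 'I_r := Ordinal (ltn_pmod i (ltn0Sn c.+1)).

Lemma residueE i j : (residue i == residue j) = (i %% r == j %% r).
Proof. by []. Qed.

Lemma mem_turan_edge_list p :
  (p \in turan_edge_list n r) = (p.1 < p.2) && (residue p.1 != residue p.2).
Proof. by rewrite mem_sort mem_filter mem_enum andbT. Qed.

Lemma mem_first_edges p : p \in first_edges ->
  (p.1 < p.2) && (residue p.1 != residue p.2).
Proof. by move/mem_take; rewrite mem_turan_edge_list. Qed.

Lemma uniq_turan_edge_list : uniq (turan_edge_list n r).
Proof. by rewrite sort_uniq filter_uniq // enum_uniq. Qed.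

(** An initial segment of a sorted list is closed downwards. *)
Lemma first_edges_down p q : p \in first_edges ->
  q \in turan_edge_list n r -> colex q p -> q \in first_edges.
Proof.
move=> pQ; rewrite -{1}(cat_take_drop e (turan_edge_list n r)) mem_cat.
case/orP=> // qD qp.
have trans : transitive (@colex n).
  by move=> [a b] [a' b'] [a'' b'']; rewrite /colex /= -!val_eqE /=; lia.
have total : total (@colex n).
  by move=> [a b] [a' b']; rewrite /colex /= -!val_eqE /=; lia.
have := sort_sorted total
  [seq p : V * V <- enum {: V * V} | (p.1 < p.2) && turan n r p.1 p.2].
rewrite -/(turan_edge_list n r) -{1}(cat_take_drop e (turan_edge_list n r)).
rewrite sorted_pairwise // pairwise_cat => /andP[/allrelP/(_ p q pQ qD) pq _].
have -> // : q = p.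
case: p q pq qp {pQ qD} => [a b] [a' b']; rewrite /colex /= -!val_eqE /= => h1 h2.
by congr (_, _); apply: val_inj => /=; lia.
Qed.

Definition below m : {set V} := [set i : V | i < m].

Lemma below_step (m : V) : below m.+1 :\ m = below m.
Proof. by apply/setP=> i; rewrite !inE -val_eqE /= ltnS ltn_neqAle. Qed.

Definition back (j : V) : {set V} := [set i : V | (i < j) && (residue i != residue j)].

Lemma card_back j : #|back j| = turan_deg r j.
Proof.
have jn : j <= n by exact: ltnW.
have cnt := @card_residue c.+1 j (j %% r) (ltn_pmod j (ltn0Sn c.+1)).
rewrite ltnn addn0 in cnt.
have : \sum_(i < j) (i %% r == j %% r) + \sum_(i < j) (i %% r != j %% r) = j.
  rewrite -big_split /= -[RHS]card_ord -sum1_card; apply: eq_bigr => i _.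
  by case: (_ == _).
rewrite cnt /turan_deg => E; rewrite -{1}E addKn -sum1_card.
rewrite (big_ord_widen n (fun i => (i %% r != j %% r) : nat)) //.
rewrite [LHS]big_mkcond [RHS]big_mkcond; apply: eq_bigr => i _.
by rewrite inE residueE; case: (i < j); case: eqP.
Qed.

Lemma turan_sym : symmetric (turan n r).
Proof. by move=> i j; rewrite /turan eq_sym. Qed.

Lemma induced_edges_turan m : m <= n ->
  induced_edges (turan n r) (below m) = turan_edges r m.
Proof.
elim: m => [_|m IH mn].
  apply/eqP; rewrite turan_edges0 cards_eq0 -subset0; apply/subsetP=> A; rewrite !inE.
  case/andP=> /edgesP[x [y [_ ->]]]; rewrite subUset sub1set inE ltn0 //.
pose u := Ordinal mn; have uS : u \in below m.+1 by rewrite inE /=.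
have := induced_edges_del turan_sym uS.
rewrite (below_step u) IH ?(ltnW mn) // turan_edgesS => ->.
congr (_ + _); rewrite -(card_back u); apply: eq_card => i.
rewrite !inE /= ltnS /turan residueE eq_sym.
by case: ltngtP => //= ->; rewrite eqxx.
Qed.

Lemma card_edges_turan : #|edges (turan n r)| = turan_edges r n.
Proof.
rewrite -induced_edges_turan // -induced_edges_setT.
congr induced_edges; apply/setP=> i.
by rewrite !inE ltn_ord.
Qed.

Definition pairs_below m : {set V * V} :=
  [set p | (p \in turan_edge_list n r) && (p.2 < m)].

Lemma card_pairs_below m : m <= n -> #|pairs_below m| = turan_edges r m.
Proof.
elim: m => [_|m IH mn].
  apply/eqP; rewrite turan_edges0 cards_eq0 -subset0.
  by apply/subsetP=> A; rewrite inE andbF.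
pose u := Ordinal mn; rewrite turan_edgesS -IH ?(ltnW mn) // -(card_back u).
rewrite -(card_imset (mem (back u)) (_ : injective (fun i => (i, u))));
  last by move=> i j [].
rewrite -[LHS](cardsID (pairs_below m)); congr (_ + _); apply: eq_card => -[i j].
  by rewrite !inE /= andbC; case: (_ \in _) => //=; case: ltnP => //= /ltnW.
rewrite !inE /= mem_turan_edge_list /= ltnS; apply/idP/imsetP => [|[x]].
  case/and3P; rewrite negb_and -leqNgt => h ij jm.
  have ju : j = u by apply: val_inj => /=; move: h; rewrite ij /=; lia.
  by exists i; rewrite ?ju // inE -ju.
rewrite inE => /andP[xm rx] [-> ->]; rewrite /= xm rx /=; lia.
Qed.

(** Moving back to residue b in the preceding block of r numbers injects the
    elements of residue a outside the first block into those of residue b, and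
    the first block contains at most one element of residue a. *)
Lemma downset_balanced (S : {set V}) (J : {set 'I_r}) :
    {in S, forall x y : V, y < x -> residue y \in J -> y \in S} ->
  {in J &, forall a b,
    #|[set x in S | residue x == a]| <= #|[set x in S | residue x == b]|.+1}.
Proof.
move=> down a b aJ bJ.
(* The default value is never taken when x is outside the first block. *)
pose g (x : V) : V := insubd x ((x %/ r - 1) * r + b).
have gE (x : V) : 0 < x %/ r -> (g x : nat) = (x %/ r - 1) * r + b /\ g x < x.
  move=> x0; have lt : (x %/ r - 1) * r + b < x.
    have := ltn_ord b; have := leq_trunc_div x r; move: x0.
    by case: (x %/ r) => // q _; rewrite subn1 /= mulSn; lia.
  by rewrite /g val_insubd (ltn_trans lt (ltn_ord x)).
set Sa := [set x in S | _ == a].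
rewrite -[#|Sa|](cardsID [set x : V | 0 < x %/ r]) addnC -[leqRHS]add1n leq_add //.
  apply/card_le1_eqP => x y; rewrite !inE -!leqNgt !leqn0.
  move=> /and3P[/eqP x0 _ /eqP xa] /and3P[/eqP y0 _ /eqP ya].
  apply: val_inj; rewrite /= (divn_eq x r) (divn_eq y r) x0 y0.
  by have := congr1 val xa; have := congr1 val ya => /= -> ->.
rewrite -(card_in_imset (f := g)).
  apply/subset_leq_card/subsetP=> _ /imsetP[x /setIP[+ +] ->]; rewrite !inE.
  case/andP=> xS xa x0; have [gx gl] := gE x x0.
  have gb : residue (g x) == b.
    by rewrite -val_eqE /= gx modnMDl modn_small.
  by rewrite gb andbT (down x) // (eqP gb).
move=> x y /setIP[+ +] /setIP[+ +]; rewrite !inE.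
move=> /andP[_ /eqP xa] x0 /andP[_ /eqP ya] y0 gxy.
have [gx _] := gE x x0; have [gy _] := gE y y0.
apply: val_inj; rewrite /= (divn_eq x r) (divn_eq y r).
have := congr1 val xa; have := congr1 val ya => /= -> ->.
move: gx; rewrite gxy gy => /addIn/eqP; rewrite eqn_pmul2r // => /eqP.
move: x0 y0; case: (x %/ r) => // q _; case: (y %/ r) => // q' _.
by rewrite !subn1 /= => ->.
Qed.

Section Stage.
Variable m : V.
Hypotheses (em : turan_edges r m < e) (eM : e <= turan_edges r m.+1).

Lemma card_first_edges : #|[set p in first_edges]| = e.
Proof.
rewrite cardsE (card_uniqP _) ?take_uniq ?uniq_turan_edge_list // size_takel //.
have := card_pairs_below (leqnn n).
have -> : #|pairs_below n| = size (turan_edge_list n r).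
  rewrite -(card_uniqP uniq_turan_edge_list) -cardsE; apply: eq_card => p.
  by rewrite !inE ltn_ord andbT.
by move=> ->; apply: leq_trans eM _; apply: leq_turan_edges.
Qed.

Lemma first_edges_below p : p \in turan_edge_list n r -> p.2 < m -> p \in first_edges.
Proof.
move=> pL pm; apply: contraT => npQ; suff : e <= turan_edges r m by lia.
rewrite -card_first_edges -(card_pairs_below (ltnW (ltn_ord m))).
apply/subset_leq_card/subsetP=> q; rewrite inE => qQ; rewrite inE (mem_take qQ) /=.
rewrite ltnNge; apply: contra npQ => mq; apply: (first_edges_down qQ) => //.
by rewrite /colex (leq_trans pm mq).
Qed.

Lemma first_edges_above p : p \in first_edges -> p.2 <= m.
Proof.
move=> pQ; rewrite leqNgt; apply/negP => mp.
suff : turan_edges r m.+1 < e by lia.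
rewrite -card_first_edges -(card_pairs_below (ltn_ord m)).
apply/proper_card/properP; split.
  apply/subsetP=> q; rewrite !inE => /andP[qL qm]; apply: (first_edges_down pQ qL).
  by rewrite /colex (leq_trans qm mp).
by exists p; rewrite !inE // negb_and ltnS -ltnNge mp orbT.
Qed.

Definition last_nbr : {set V} := [set i : V | (i, m) \in first_edges].

Lemma card_last_nbr : #|last_nbr| = e - turan_edges r m.
Proof.
rewrite -{1}card_first_edges -[#|[set p in first_edges]|](cardsID (pairs_below m)).
have -> : [set p in first_edges] :&: pairs_below m = pairs_below m.
  apply/setIidPr/subsetP=> p; rewrite !inE => /andP[pL pm]; exact: first_edges_below.
rewrite card_pairs_below; last exact: ltnW.
rewrite addKn -(card_imset (mem last_nbr) (_ : injective (fun i => (i, m))));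
  last by move=> i j [].
apply: eq_card => -[i j]; rewrite !inE; apply/imsetP/idP => [[x]|].
  by rewrite inE => xQ [-> ->]; rewrite xQ andbT ltnn andbF.
case/andP=> h ij_first; have jm : j = m.
  apply: val_inj; apply/eqP; rewrite eqn_leq (first_edges_above ij_first) leqNgt.
  by move: h; rewrite (mem_take ij_first).
by exists i; rewrite ?inE -jm.
Qed.

Lemma H_graph_sym : symmetric H.
Proof. by move=> i j; rewrite /H /H_graph orbC. Qed.

Lemma H_graph_turan i j : H i j -> residue i != residue j.
Proof. by case/orP=> /mem_first_edges /andP[_] //; rewrite eq_sym. Qed.

Lemma H_graph_irr : irreflexive H.
Proof. by move=> i; apply/negP => /H_graph_turan; rewrite eqxx. Qed.

Lemma H_graph_below : {in below m &, forall i j, H i j = (residue i != residue j)}.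
Proof.
move=> i j; rewrite !inE => im jm; apply/idP/idP => [/H_graph_turan //|ij].
rewrite /H /H_graph; case: (ltngtP i j) => [lt|lt|/val_inj E].
- by rewrite first_edges_below // mem_turan_edge_list lt.
- by rewrite orbC first_edges_below // mem_turan_edge_list lt eq_sym.
- by rewrite E eqxx in ij.
Qed.

Lemma last_nbr_below : last_nbr \subset below m.
Proof. by apply/subsetP=> i; rewrite !inE => /mem_first_edges /andP[]. Qed.

Lemma nbr_last : nbr H (below m.+1) m = last_nbr.
Proof.
apply/setP=> i; rewrite !inE ltnS /H /H_graph.
case: (boolP ((m, i) \in first_edges)) => [/mem_first_edges/= /andP[mi _]|_] /=.
  rewrite leqNgt mi /=; apply/esym/negP => /mem_first_edges/= /andP[]; lia.
by rewrite andb_idl // => /mem_first_edges/= /andP[/ltnW].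
Qed.

(** The clique number of H_e is at most c + 2, so that the cycles in top degree
    are all of its homology there.  If m <= c + 1, then the link of the last
    vertex has too few vertices to contribute.  Otherwise the vertex m %% r
    precedes m, lies in the same class and dominates it. *)
Theorem H_graph_lower (F : fieldType) :
  turan_betti r m + turan_betti c.+1 (e - turan_edges r m) <=
  betti F (flag_complex H) c.+1.
Proof.
rewrite (bettiE F H_graph_sym) ibetti_cycles; last first.
  apply/eqP; rewrite -subv0; apply/subvP=> x /supportedP x0; rewrite memv0.
  apply/eqP/ffunP=> A.
  rewrite ffunE x0 //; apply/negP => /and3P[/cliqueP cl _ /eqP cA].
  have inj : {in A &, injective residue}.
    move=> i j iA jA E; apply/eqP; apply: contraT => ij.
    by have := H_graph_turan (cl _ _ iA jA ij); rewrite E eqxx.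
  have := max_card (mem [set residue i | i in A]).
  by rewrite card_in_imset // cA card_ord ltnn.
have cb : #|below m| = m.
  rewrite -sum1_card big_mkcond -[RHS]card_ord -sum1_card.
  rewrite (big_ord_widen n (fun=> 1)); last exact: ltnW.
  by rewrite [RHS]big_mkcond; apply: eq_bigr => i _; rewrite inE.
have zm : turan_betti r m <= \dim (cycles F H (below m) r).
  have := @cycles_balanced F V H H_graph_sym H_graph_irr 'I_r residue r (below m) setT.
  rewrite cardsT card_ord cb; apply=> //; first exact: H_graph_below.
  apply: downset_balanced => x; rewrite inE => xm y yx _.
  by rewrite inE; exact: ltn_trans xm.
apply: leq_trans (cyclesS F H r (subsetT (below m.+1))).
case: (leqP m c.+1) => [mc|cm].
  rewrite (@turan_betti_small c) ?addn0; last first.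
    apply: leq_trans mc; rewrite -card_last_nbr.
    by rewrite -cb; apply/subset_leq_card/last_nbr_below.
  apply: leq_trans zm _; apply: cyclesS; apply/subsetP=> x; rewrite !inE; exact: leqW.
have wn : m %% r < n by apply: leq_ltn_trans (leq_mod _ _) (ltn_ord m).
pose w : V := Ordinal wn.
have wm : w < m by apply: leq_trans (ltn_pmod m (ltn0Sn c.+1)) cm.
have mS : m \in below m.+1 by rewrite inE.
have wr : residue w = residue m by apply: val_inj; rewrite /= modn_mod.
have := @cycles_twin F V H H_graph_sym H_graph_irr (below m.+1) c.+1 m w mS.
rewrite nbr_last below_step; move=> tw; apply: leq_trans (tw _ _ _ _).
- apply: leq_add zm _; rewrite -card_last_nbr.
  apply: (@cycles_balanced F V H H_graph_sym H_graph_irr 'I_r residue c.+1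
            last_nbr [set~ residue m]).
  + by rewrite cardsC1 card_ord.
  + by move=> x; rewrite !inE => /mem_first_edges /andP[].
  + move=> x y /(subsetP last_nbr_below) xm /(subsetP last_nbr_below) ym.
    exact: H_graph_below.
  apply: downset_balanced => x xm y yx yr; rewrite inE in xm; rewrite inE.
  have /andP[/= xm' _] := mem_first_edges xm.
  apply: (first_edges_down xm); last by rewrite /colex /= eqxx ltnn /= ltnW.
  by rewrite mem_turan_edge_list /= (ltn_trans yx) //=; move: yr; rewrite !inE.
- by rewrite inE; apply: leqW.
- by rewrite -val_eqE /= gtn_eqF.
- by apply/negP => /H_graph_turan; rewrite wr eqxx.
move=> x xS mx; have /H_graph_turan := mx.
rewrite H_graph_below ?inE // ?wr // ltn_neqAle.
rewrite inE ltnS in xS; rewrite xS andbT.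
by apply: contraTneq mx => /val_inj ->; rewrite H_graph_irr.
Qed.
End Stage.
End Extremal.

Theorem theorem16 (F : fieldType) (n k e : nat)
    (n_ge1 : (1 <= n)%N) (k_ge1 : (1 <= k)%N)
    (e_ge1 : (1 <= e)%N) (e_le : (e <= #|edges (turan n k.+1)|)%N)
    (T : finType) (adj : rel T)
    (adj_sym : symmetric adj) (adj_irr : irreflexive adj)
    (card_vertices : #|T| = n) (card_edges : #|edges adj| = e) :
  (betti F (flag_complex adj) k <= betti F (flag_complex (H_graph n k.+1 e)) k)%N.
Proof.
case: k k_ge1 e_le => // c _; rewrite card_edges_turan => e_le.
have [|m [t [_ mn eE /andP[t_gt0 t_le]]]] := @exists_turan_edges_level c.+1 0 n e.
  by rewrite turan_edges0 e_ge1.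
have upper : betti F (flag_complex adj) c.+1 <= turan_betti c.+2 m + turan_betti c.+1 t.
  rewrite (bettiE F adj_sym); apply: (ibetti_edges F adj_sym adj_irr t_le).
  by rewrite induced_edges_setT card_edges eE.
have lower := @H_graph_lower n c e (Ordinal mn) _ _ F.
apply: leq_trans upper _; rewrite eE addKn in lower *.
by apply: lower; rewrite /= ?turan_edgesS; lia.
Qed.
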